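(* Let $F$ be an entire function with at least one zero, and $\ell\in\mathbb{Z}$. Its Newton map $N_F(z)=z-F(z)/F'(z)$ belongs to the class $\mathbf{R}_\ell$ if and only if $\ell=1$ and $$F(z)=e^{\Lambda z}\Psi(e^{2\pi iz}),\qquad \Psi(w)=w^{m_0}P(w)e^{Q(w)+\widetilde{Q}(1/w)},$$ where $\Lambda\in\mathbb{C}$, $m_0\in\mathbb{Z}$, and $P,Q,\widetilde{Q}$ are polynomials with $P(0)\neq0$ and $P^{-1}(0)\cap\mathbb{C}^*\neq\emptyset$; in addition $\Lambda\neq-2\pi i(m_0+\deg P)$ if $Q$ is constant, and $\Lambda\neq-2\pi i m_0$ if $\widetilde{Q}$ is constant.
   Context: For $\ell\in\mathbb{Z}$, $\mathbf{R}_\ell$ is the class of meromorphic functions $f(z)=\ell z+R(e^{2\pi iz})$ where $R$ is a non-constant rational map with $R(0)\neq\infty$, $R(\infty)\neq\infty$ and $R^{-1}(\infty)\neq\emptyset$ (i.e. $R=\frac{a_nw^n+\dots+a_0}{b_mw^m+\dots+b_0}$ with coprime numerator and denominator, $m\ge\max\{n,1\}$, $a_n,b_m,b_0\neq0$). *)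

(* Defs.v *)
From HB Require Import structures.
From mathcomp Require Import all_boot all_order all_algebra.
From mathcomp Require Import all_classical all_reals all_analysis.
From mathcomp Require Import complex.
Set Implicit Arguments.
Unset Strict Implicit.
Unset Printing Implicit Defensive.
Import Order.TTheory GRing.Theory Num.Theory.
Import numFieldNormedType.Exports.
Local Open Scope ring_scope.

(* the complex numbers C = R[i], viewed as a numClosedFieldType, hence
   (via numFieldNormedType) a normed module over itself: derivatives below
   are complex derivatives. *)
Definition CC (R : realType) : numClosedFieldType := R[i].

Definition cexp (R : realType) (z : CC R) : CC R :=
  Complex (expR (complex.Re z) * cos (complex.Im z)) (expR (complex.Re z) * sin (complex.Im z)) : R[i].

Definition two_pi_i (R : realType) : CC R := Complex 0 (2 * pi) : R[i].

Definition entire (R : realType) (F : CC R -> CC R) : Prop :=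
  forall z : CC R, derivable F z 1.

Definition cderiv (R : realType) (F : CC R -> CC R) (z : CC R) : CC R :=
  'D_1 F z.

(* Newton map N_F(z) = z - F(z)/F'(z) (meaningful where F'(z) <> 0) *)
Definition newton (R : realType) (F : CC R -> CC R) (z : CC R) : CC R :=
  z - F z / cderiv F z.

(* R = p/q (p, q coprime) is an admissible rational map for the class R_l:
   non-constant, R(0) <> oo, R(oo) <> oo, R^{-1}(oo) nonempty. *)
Definition admissible_rat (R : realType) (p q : {poly CC R}) : Prop :=
  [/\ coprimep p q,
      (exists w1 w2 : CC R, [/\ q.[w1] != 0, q.[w2] != 0 &
                               p.[w1] / q.[w1] != p.[w2] / q.[w2]]),
      (* R(0) <> oo *) q.[0] != 0,
      (* R(oo) <> oo *) (size p <= size q)%N &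
      (* R^{-1}(oo) <> empty *) (exists w : CC R, root q w)].

(* The meromorphic function N_F belongs to R_l: N_F(z) = l z + R(e^{2 pi i z})
   as meromorphic functions, i.e. equality wherever both formulas are defined
   (the complement of a discrete set). *)
Definition newton_in_Rl (R : realType) (F : CC R -> CC R) (l : int) : Prop :=
  exists p q : {poly CC R}, admissible_rat p q /\
    forall z : CC R, cderiv F z != 0 -> q.[cexp (two_pi_i R * z)] != 0 ->
      newton F z = l%:~R * z + p.[cexp (two_pi_i R * z)] / q.[cexp (two_pi_i R * z)].

(* Main.v *)
Require Import Defs.
From HB Require Import structures.
From mathcomp Require Import all_boot all_order all_algebra.
From mathcomp Require Import all_classical all_reals all_analysis.
From mathcomp Require Import complex.
From mathcomp Require Import separable ring lra.
Import Order.TTheory GRing.Theory Num.Theory.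
Import numFieldNormedType.Exports.
Local Open Scope classical_set_scope.
Local Open Scope ring_scope.

Set Implicit Arguments.
Unset Strict Implicit.
Unset Printing Implicit Defensive.

(** Put [w = e^(2 pi i z)], [c = 1 - l] and [H(z) = c z q(w) - p(w)]. The Newton
    equation says that [F' = 0] or [F' / F = q(w) / H] off a discrete set. The
    complement of a discrete set is connected, and derivatives have the
    intermediate value property (Darboux), so the first alternative never occurs
    and [F] solves the linear equation [F' H = F q(w)]. No integral theorem is
    needed: [H] is an explicit exponential polynomial, so its zeros have finite
    order. At a zero of [H] the boundedness of [F] on rays and the
    single-valuedness of [F] on circles force [q(w) / H] to have a simple pole
    whose residue is a positive integer.

    If [c <> 0], the minimum modulus principle produces zeros of [H] with [w]
    arbitrarily close to a pole of [p / q]; there [1 / residue = H' / q(w)] is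
    large, a contradiction. Hence [l = 1], and [- q / p] has only simple poles
    outside [0], with positive integral residues after division by [2 pi i w].
    Its partial fraction decomposition integrates to [log F], which is the
    required form. Conversely that form gives [F' / F] as an explicit reduced
    rational function of [w], and the two inequalities on [Lam] say that it does
    not vanish at [0] and at [oo]. *)

(** * Modulus and topology of the complex plane *)

(** The Newton equation is assumed only where [F' <> 0], so a priori [F] could be constant on some
    open set and solve the linear equation elsewhere. Analytic continuation would exclude this;
    Darboux's theorem replaces it, and the zero of [F] then rules out that [F] is constant
    everywhere.

    The case [c <> 0] rests on an identity at the zeros of [H]: there [c z = p / q], hence [H' / q =
    c + 2 pi i w (p q' - p' q) / q^2]. The left side is the inverse [1 / (n + 1)] of a residue and
    lies in []0, 1]]. The fraction on the right is unbounded near a pole of [p / q]: a zero of [q]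
    of order [m + 1], where [p] does not vanish, is a zero of [p q' - p' q] of order [m] only. For
    [c = 0] there is no conflict, because [H = - p] has no zero near a pole. *)

Section Modulus.
Variable R : realType.
Implicit Types (z w : CC R) (r : R).

(** The norm of [CC R] takes its values in [CC R]. Its real part lives in the ordered field [R],
    where estimates can be left to [lra] and [nra]. *)
Definition cabs z : R := complex.Re `|z|.
Definition ofR r : CC R := (r%:C)%C.

Lemma ofR_abs z : ofR (cabs z) = `|z|.
Proof. by rewrite /ofR /cabs normc_def. Qed.

HB.instance Definition _ := GRing.RMorphism.copy ofR (real_complex R).

Lemma ofRI : injective ofR. Proof. exact: complexI. Qed.
Lemma ler_ofR r s : (ofR r <= ofR s) = (r <= s). Proof. exact: lecR. Qed.
Lemma ltr_ofR r s : (ofR r < ofR s) = (r < s). Proof. exact: ltcR. Qed.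

Lemma cabs_ge0 z : 0 <= cabs z.
Proof. by rewrite -ler_ofR ofR_abs rmorph0. Qed.
Lemma cabsM z w : cabs (z * w) = cabs z * cabs w.
Proof. by apply: ofRI; rewrite rmorphM /= !ofR_abs normrM. Qed.
Lemma cabsV z : cabs z^-1 = (cabs z)^-1.
Proof. by apply: ofRI; rewrite fmorphV /= !ofR_abs normfV. Qed.
Lemma cabsX z n : cabs (z ^+ n) = cabs z ^+ n.
Proof. by apply: ofRI; rewrite rmorphXn /= !ofR_abs normrX. Qed.
Lemma cabsN z : cabs (- z) = cabs z.
Proof. by rewrite /cabs normrN. Qed.
Lemma cabsD z w : cabs (z + w) <= cabs z + cabs w.
Proof. by rewrite -ler_ofR rmorphD /= !ofR_abs ler_normD. Qed.
Lemma cabsC z w : cabs (z - w) = cabs (w - z).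
Proof. by rewrite /cabs distrC. Qed.
Lemma cabsB z w : cabs (z - w) <= cabs z + cabs w.
Proof. by rewrite -ler_ofR rmorphD /= !ofR_abs ler_normB. Qed.
Lemma cabs0 : cabs 0 = 0. Proof. by rewrite /cabs normr0. Qed.
Lemma cabs1 : cabs 1 = 1. Proof. by rewrite /cabs normr1. Qed.
Lemma cabs_eq0 z : (cabs z == 0) = (z == 0).
Proof. by rewrite -(inj_eq ofRI) ofR_abs rmorph0 normr_eq0. Qed.
Lemma cabs_gt0 z : (0 < cabs z) = (z != 0).
Proof. by rewrite lt_neqAle eq_sym cabs_eq0 cabs_ge0 andbT. Qed.
Lemma cabs_ofR r : cabs (ofR r) = `|r|.
Proof. by rewrite /cabs normc_def /= expr0n /= addr0 sqrtr_sqr. Qed.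
Lemma cabs_dist z w : cabs z - cabs w <= cabs (z - w).
Proof. by rewrite lerBlDr -{1}(subrK w z) cabsD. Qed.

Lemma cabs_sqr z : cabs z ^+ 2 = complex.Re z ^+ 2 + complex.Im z ^+ 2.
Proof. by apply: ofRI; rewrite rmorphXn /= ofR_abs -add_Re2_Im2. Qed.

Lemma Re_le_cabs z : `|complex.Re z| <= cabs z.
Proof.
by rewrite -ler_sqr ?nnegrE ?normr_ge0 ?cabs_ge0// cabs_sqr real_normK ?num_real// lerDl sqr_ge0.
Qed.
Lemma Im_le_cabs z : `|complex.Im z| <= cabs z.
Proof.
by rewrite -ler_sqr ?nnegrE ?normr_ge0 ?cabs_ge0// cabs_sqr real_normK ?num_real// lerDr sqr_ge0.
Qed.

Lemma cabs_le_ReIm z : cabs z <= `|complex.Re z| + `|complex.Im z|.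
Proof.
rewrite -ler_sqr ?nnegrE ?addr_ge0 ?normr_ge0 ?cabs_ge0// cabs_sqr sqrrD !real_normK ?num_real//.
by rewrite -addrA [X in _ <= _ + X]addrC addrA lerDl mulrn_wge0 ?mulr_ge0.
Qed.

Lemma cReD z w : complex.Re (z + w) = complex.Re z + complex.Re w.
Proof. by case: z w => [a b] [c d]. Qed.
Lemma cImD z w : complex.Im (z + w) = complex.Im z + complex.Im w.
Proof. by case: z w => [a b] [c d]. Qed.
Lemma cReM z w : complex.Re (z * w) =
  complex.Re z * complex.Re w - complex.Im z * complex.Im w.
Proof. by case: z w => [a b] [c d]. Qed.
Lemma cImM z w : complex.Im (z * w) =
  complex.Re z * complex.Im w + complex.Im z * complex.Re w.
Proof. by case: z w => [a b] [c d]. Qed.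
Lemma cReB z w : complex.Re (z - w) = complex.Re z - complex.Re w.
Proof. by case: z w => [a b] [c d]. Qed.
Lemma cImB z w : complex.Im (z - w) = complex.Im z - complex.Im w.
Proof. by case: z w => [a b] [c d]. Qed.
Lemma CC_eqP z w : complex.Re z = complex.Re w -> complex.Im z = complex.Im w -> z = w.
Proof. by case: z w => [a b] [c d] /= -> ->. Qed.

(** Balls in [CC R] have their radii in [CC R], and a positive element of that order is real; this
    exchanges them for radii in [R]. *)
Lemma near_CCP (z : CC R) (P : CC R -> Prop) :
  (\forall x \near z, P x) <->
  exists2 d : R, 0 < d & forall x, cabs (x - z) < d -> P x.
Proof.
split.
  move=> /nbhs_ballP[e /= e0 He].
  have eE : e = ofR (complex.Re e).
    by case: e e0 {He} => a b; rewrite ltcE /= => /andP[/eqP -> _].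
  exists (complex.Re e); first by rewrite -ltr_ofR -eE rmorph0.
  move=> x xd; apply: He; rewrite /ball/= /ball_ /= eE -ofR_abs ltr_ofR.
  by rewrite cabsC.
move=> [d d0 Hd]; apply/nbhs_ballP; exists (ofR d) => /=.
  by rewrite -(rmorph0 ofR) ltr_ofR.
by move=> x; rewrite /ball/= /ball_ /= -ofR_abs ltr_ofR cabsC => /Hd.
Qed.

Lemma continuous_CCP (f : CC R -> CC R) z :
  {for z, continuous f} <->
  forall e : R, 0 < e -> \forall x \near z, cabs (f x - f z) < e.
Proof.
split.
  move=> fz e e0; have := fz [set y | cabs (y - f z) < e]; apply.
  by apply/near_CCP; exists e.
move=> H A /near_CCP[e e0 He]; have := H _ e0.
by apply: filterS => x /He.
Qed.

Lemma continuous_CRP (f : CC R -> R) z :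
  {for z, continuous f} <->
  forall e : R, 0 < e -> \forall x \near z, `|f x - f z| < e.
Proof.
split.
  move=> fz e e0; have := fz [set y | `|y - f z| < e]; apply.
  by apply/nbhs_ballP; exists e => //= y; rewrite /ball /= distrC.
move=> H A /nbhs_ballP[e /= e0 He]; have := H _ e0.
by apply: filterS => x; rewrite distrC => /He.
Qed.

Lemma continuous_RCP (f : R -> CC R) t :
  {for t, continuous f} <->
  forall e : R, 0 < e -> \forall x \near t, cabs (f x - f t) < e.
Proof.
split.
  move=> fz e e0; have := fz [set y | cabs (y - f t) < e]; apply.
  by apply/near_CCP; exists e.
move=> H A /near_CCP[e e0 He]; have := H _ e0.
by apply: filterS => x /He.
Qed.

Lemma continuous_cabs : continuous cabs.
Proof.
move=> z; apply/continuous_CRP => e e0; apply/near_CCP; exists e => // x.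
apply: le_lt_trans; rewrite ler_norml cabs_dist andbT lerNl opprB.
by rewrite cabsC cabs_dist.
Qed.

Lemma continuous_Re : continuous (@complex.Re R : CC R -> R).
Proof.
move=> z; apply/continuous_CRP => e e0; apply/near_CCP; exists e => // x.
by apply: le_lt_trans; rewrite -cReB Re_le_cabs.
Qed.

Lemma continuous_ofR : continuous ofR.
Proof.
move=> t; apply/continuous_RCP => e e0; apply/nbhs_ballP; exists e => //= x.
by rewrite /ball /= -rmorphB /= cabs_ofR distrC.
Qed.

End Modulus.

(** * Complex derivatives *)

Section ComplexDerivative.
Variable K : numClosedFieldType.
Implicit Types (z w : K) (f g : K -> K).

Lemma near_neqP z (P : K -> Prop) : (\forall x \near z^', P x) <->
  (\forall x \near z, x != z -> P x).
Proof. by []. Qed.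

Lemma cont_cst (a z : K) : {for z, continuous (fun=> a : K)}.
Proof. exact: cst_continuous. Qed.

Lemma cont_id (z : K) : {for z, continuous (@id K)}.
Proof. by move=> A. Qed.

Lemma contD f g z : {for z, continuous f} -> {for z, continuous g} ->
  {for z, continuous (fun x => f x + g x)}.
Proof. by move=> fz gz; apply: continuousD. Qed.

Lemma contN f z : {for z, continuous f} -> {for z, continuous (fun x => - f x)}.
Proof. by move=> fz; apply: continuousN. Qed.

Lemma contM f g z : {for z, continuous f} -> {for z, continuous g} ->
  {for z, continuous (fun x => f x * g x)}.
Proof. by move=> fz gz; apply: (@continuousM K K). Qed.

Lemma contV f z : f z != 0 -> {for z, continuous f} ->
  {for z, continuous (fun x => (f x)^-1)}.
Proof. by move=> fz0 fz; apply: (@continuousV K K). Qed.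

Lemma cont_comp f g z : {for z, continuous f} -> {for f z, continuous g} ->
  {for z, continuous (fun x => g (f x))}.
Proof. by move=> fz gz; apply: (@continuous_comp _ _ _ f g). Qed.

Lemma cont_near_neq0 f z : {for z, continuous f} -> f z != 0 ->
  \forall x \near z, f x != 0.
Proof.
move=> fz f0; have /fz : nbhs (f z) [set y | y != 0]; last by [].
apply/nbhs_ballP; exists `|f z| => /=; first by rewrite normr_gt0.
by move=> y; rewrite /ball /=; apply: contraTneq => ->; rewrite subr0 ltxx.
Qed.

(* Caratheodory's form of [f'(z) = d]. *)
Definition CD f z d := exists2 g : K -> K, {for z, continuous g} &
  g z = d /\ forall x, f x = f z + g x * (x - z).

Lemma CD_slope f z d : (fun x => (f x - f z) / (x - z)) @ z^' --> d -> CD f z d.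
Proof.
move=> fd; exists (fun x => if x == z then d else (f x - f z) / (x - z)); last first.
  split=> [|x]; first by rewrite eqxx.
  case: eqVneq => [->|xz]; first by rewrite subrr mulr0 addr0.
  by rewrite divfK ?subr_eq0// addrC subrK.
move=> A; rewrite eqxx => dA; have /near_neqP := fd _ dA.
have := nbhs_singleton dA => Ad; apply: filterS => x H.
by rewrite /preimage /=; case: eqVneq H => [_ _ //|xz]; apply.
Qed.

Lemma derivable_CD f z : derivable f z 1 -> CD f z ('D_1 f z).
Proof.
move=> fz; set d := 'D_1 f z; apply: CD_slope.
have fd : (fun h : K => h^-1 *: (f (h *: 1 + z) - f z)) @ 0^' --> d by exact: fz.
move=> A /fd /near_neqP H; apply/near_neqP.
suff : \forall x \near z, x - z != 0 -> A ((x - z)^-1 *: (f ((x - z) *: 1 + z) - f z)).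
  apply: filterS => x; rewrite subr_eq0 => Ax xz; have := Ax xz.
  by rewrite /= /GRing.scale /= mulr1 subrK mulrC.
have : {for z, continuous (fun x => x - z)}.
  by apply: contD; [exact: cont_id|exact: cont_cst].
move=> /(_ [set h | h != 0 -> A (h^-1 *: (f (h *: 1 + z) - f z))]); apply.
by rewrite subrr.
Qed.

Lemma CD_continuous f z d : CD f z d -> {for z, continuous f}.
Proof.
case=> g gz [_ fE].
have -> : f = fun x => f z + g x * (x - z) by apply/funext.
apply: contD; first exact: cont_cst.
by apply: contM => //; apply: contD; [exact: cont_id|exact: cont_cst].
Qed.

(** The two slope functions agree off [z]. If they differed at [z], continuity would make them
    differ nearby, and a ball would reduce to its centre. *)
Lemma CD_uniq f z d d' : CD f z d -> CD f z d' -> d = d'.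
Proof.
move=> [g gz [gd fg]] [k kz [kd fk]].
have gk : {for z, continuous (fun x => g x - k x)} by apply: contD => //; exact: contN.
apply/eqP; apply: contraT => dd; have /(cont_near_neq0 gk) : g z - k z != 0.
  by rewrite gd kd subr_eq0.
move=> H; have : \forall x \near z, x = z.
  apply: filterS H => x; apply: contraNeq => xz.
  have /addrI := etrans (esym (fg x)) (fk x).
  by move/mulIf; rewrite subr_eq0 => /(_ xz) ->; rewrite subrr.
move=> /nbhs_ballP[e /= e0 He].
have /He : ball z e (z + e / 2).
  rewrite /ball /= opprD addrA subrr sub0r normrN gtr0_norm ?divr_gt0//.
  by rewrite ltr_pdivrMr// mulr_natr mulr2n ltrDl.
move/eqP; rewrite -subr_eq0 addrAC subrr add0r mulf_eq0 invr_eq0 pnatr_eq0 orbF.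
by rewrite gt_eqF.
Qed.

Lemma CD_ext f g z d : f =1 g -> CD f z d -> CD g z d.
Proof. by move=> /funext ->. Qed.

Lemma CD_cst a z : CD (fun=> a) z 0.
Proof.
by exists (fun=> 0); [exact: cont_cst|split=> // x; rewrite mul0r addr0].
Qed.

Lemma CD_id z : CD id z 1.
Proof.
by exists (fun=> 1); [exact: cont_cst|split=> // x; rewrite mul1r addrC subrK].
Qed.

Lemma CDD f g z d e : CD f z d -> CD g z e -> CD (fun x => f x + g x) z (d + e).
Proof.
move=> [f' f'z [<- fE]] [g' g'z [<- gE]].
exists (fun x => f' x + g' x); first exact: contD.
by split=> // x; rewrite {1}fE {1}gE; ring.
Qed.

Lemma CDM f g z d e : CD f z d -> CD g z e ->
  CD (fun x => f x * g x) z (d * g z + f z * e).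
Proof.
move=> Cf Cg; have gz := CD_continuous Cg.
case: Cf => [f' f'z [<- fE]]; case: Cg => [g' g'z [<- gE]].
exists (fun x => f' x * g x + f z * g' x).
  by apply: contD; apply: contM => //; exact: cont_cst.
split=> // x; have -> : f x * g x = f z * g x + f' x * (x - z) * g x by rewrite {1}fE; ring.
by rewrite {1}gE; ring.
Qed.

Lemma CD_comp f g z d e : CD g z d -> CD f (g z) e -> CD (fun x => f (g x)) z (e * d).
Proof.
move=> Cg; have gz := CD_continuous Cg; case: Cg => [g' g'z [<- gE]].
move=> [f' f'z [<- fE]].
exists (fun x => f' (g x) * g' x); first by apply: contM => //; exact: cont_comp.
split=> // x; rewrite [in LHS]fE; congr (_ + _); rewrite -mulrA; congr (_ * _).
by rewrite gE; ring.
Qed.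

Lemma CDZ a f z d : CD f z d -> CD (fun x => a * f x) z (a * d).
Proof. by move=> Cf; have := CDM (CD_cst a z) Cf; rewrite mul0r add0r. Qed.

Lemma CDN f z d : CD f z d -> CD (fun x => - f x) z (- d).
Proof.
move=> Cf; have := CDZ (-1) Cf; rewrite mulN1r.
by apply: CD_ext => x; rewrite mulN1r.
Qed.

Lemma CDB f g z d e : CD f z d -> CD g z e -> CD (fun x => f x - g x) z (d - e).
Proof. by move=> Cf Cg; apply: CDD => //; exact: CDN. Qed.

Lemma CD_horner (p : {poly K}) z : CD (horner p) z (p^`()).[z].
Proof.
elim/poly_ind: p => [|p a IH].
  rewrite deriv0 horner0; apply: CD_ext (CD_cst 0 z) => x.
  by rewrite horner0.
rewrite derivD derivM derivX derivC addr0 mulr1 hornerD hornerM hornerX.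
have := CDD (CDM IH (CD_id z)) (CD_cst a z); rewrite addr0 mulr1.
apply: CD_ext => x.
by rewrite hornerD hornerM hornerX hornerC.
Qed.

Lemma CDV f z d : f z != 0 -> CD f z d -> CD (fun x => (f x)^-1) z (- d / f z ^+ 2).
Proof.
move=> fz0 Cf; have fz := CD_continuous Cf; have fn0 := cont_near_neq0 fz fz0.
case: Cf => [k kz [kd fE]].
apply: CD_slope => A dA; apply/near_neqP.
have : {for z, continuous (fun x => - k x / (f x * f z))}.
  apply: contM; first exact: contN.
  apply: contV; first by rewrite mulf_neq0.
  by apply: contM => //; exact: cont_cst.
move=> /(_ A); rewrite kd -expr2 => /(_ dA) H.
have {}H : \forall x \near z, A (- k x / (f x * f z)) by exact: H.
apply: filterS2 fn0 H => x fx + xz.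
have -> : - k x / (f x * f z) = ((f x)^-1 - (f z)^-1) / (x - z); last by [].
have kE : k x = (f x - f z) / (x - z).
  by rewrite [in RHS]fE addrC addKr mulfK ?subr_eq0.
by rewrite kE; field; rewrite fx fz0 subr_eq0 xz.
Qed.

End ComplexDerivative.

(** * The complex exponential *)

Lemma is_derive_approx (R : realType) (f : R -> R) (t d : R) : is_derive t 1 f d ->
  forall e, 0 < e -> \forall x \near t, `|f x - f t - d * (x - t)| <= e * `|x - t|.
Proof.
move=> [df fd] e e0.
have : (fun h : R => h^-1 *: (f (h *: 1 + t) - f t)) @ 0^' --> d by rewrite -fd; exact: df.
move=> /cvgrPdist_lt/(_ e e0)/nbhs_ballP[r /= r0 Hr].
apply/nbhs_ballP; exists r => // x; rewrite /ball /= => xr.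
have [->|xt] := eqVneq x t; first by rewrite !subrr mulr0 subrr normr0 mulr0.
have xt0 : x - t != 0 by rewrite subr_eq0.
have := Hr (x - t); rewrite /ball /= sub0r opprB => /(_ xr xt0).
rewrite /GRing.scale /= mulr1 subrK => /ltW H.
have -> : f x - f t - d * (x - t) = - (d - (x - t)^-1 * (f x - f t)) * (x - t) by field.
by rewrite normrM normrN ler_wpM2r.
Qed.

Section ComplexExponential.
Variable R : realType.
Implicit Types (z w : CC R).

Lemma cexpD z w : cexp (z + w) = cexp z * cexp w.
Proof.
apply: CC_eqP; rewrite ?cReM ?cImM /= cReD cImD expRD ?cosD ?sinD; ring.
Qed.

Lemma cexp0 : cexp (0 : CC R) = 1.
Proof. by apply: CC_eqP => /=; rewrite expR0 ?cos0 ?sin0 ?mul1r. Qed.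

Lemma cexpN z : cexp z * cexp (- z) = 1.
Proof. by rewrite -cexpD subrr cexp0. Qed.

Lemma cexp_neq0 z : cexp z != 0.
Proof.
apply/eqP => z0; have := cexpN z; rewrite z0 mul0r => /eqP.
by rewrite eq_sym oner_eq0.
Qed.

Lemma cabs_cexp z : cabs (cexp z) = expR (complex.Re z).
Proof.
apply/eqP; rewrite -(@eqrXn2 _ 2) ?cabs_ge0 ?expR_ge0// cabs_sqr /=.
by rewrite !exprMn -mulrDr cos2Dsin2 mulr1.
Qed.

Lemma near_R0_CC (P : R -> Prop) : (\forall x \near (0:R), P x) ->
  \forall z \near (0 : CC R), P (complex.Re z) /\ P (complex.Im z).
Proof.
move=> /nbhs_ballP[e /= e0 He]; apply/near_CCP; exists e => // z; rewrite subr0 => ze.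
split; apply: He; rewrite /ball /= sub0r normrN; apply: le_lt_trans ze.
  exact: Re_le_cabs.
exact: Im_le_cabs.
Qed.

Lemma CD_cexp0 : CD (@cexp R) 0 1.
Proof.
apply: CD_slope => A /near_CCP[e e0 He]; apply/near_neqP.
(* The real and the imaginary part of [cexp z - 1 - z] will each be at most [3 * n * cabs z]; a
   seventh instead of a sixth of [e] makes the final inequality strict. *)
pose n := Num.min (e / 7) 1.
have n0 : 0 < n by rewrite lt_min divr_gt0// ltr01.
have n1 : n <= 1 by rewrite ge_min lexx orbT.
have ne : n <= e / 7 by rewrite ge_min lexx.
have E1 := @is_derive_approx R expR 0 _ (is_derive_expR 0) n n0.
have C1 := @is_derive_approx R cos 0 _ (is_derive_cos 0) n n0.
have S1 := @is_derive_approx R sin 0 _ (is_derive_sin 0) n n0.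
have E2 : \forall x \near (0:R), `|expR x - 1| < n.
  have /cvgrPdist_lt/(_ n n0) := @continuous_expR R 0.
  by apply: filterS => x; rewrite expR0 distrC.
have nI := @filterI _ _ (nbhs_filter (0 : R)).
have := near_R0_CC (nI _ _ (nI _ _ E1 E2) (nI _ _ C1 S1)).
move=> /near_CCP[d d0 Hd]; apply/near_CCP; exists d => // z /Hd.
move=> [[[E E'] _] [_ [C S]]] z0.
move: E C S; rewrite expR0 cos0 sin0 !subr0 oppr0 mul0r subr0 !mul1r.
move: E'; set X := complex.Re z; set Y := complex.Im z => E' E C S.
apply: He; rewrite subr0 cexp0.
have -> : (cexp z - 1) / z - 1 = (cexp z - 1 - z) / z by field.
rewrite cabsM cabsV ltr_pdivrMr ?cabs_gt0//.
have Ele : `|expR X| <= 2.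
  by rewrite -[expR X](subrK 1); apply: le_trans (ler_normD _ _) _; rewrite normr1; lra.
have b1 : `|X| <= cabs z by exact: Re_le_cabs.
have b2 : `|Y| <= cabs z by exact: Im_le_cabs.
have z1 : 0 < cabs z by rewrite cabs_gt0.
have h1 : `|expR X * cos Y - 1 - X| <= 3 * n * cabs z.
  have -> : expR X * cos Y - 1 - X = (expR X - 1 - X) + expR X * (cos Y - 1) by ring.
  apply: le_trans (ler_normD _ _) _; rewrite normrM.
  have : `|expR X| * `|cos Y - 1| <= 2 * (n * `|Y|) by apply: ler_pM.
  have : n * `|X| <= n * cabs z by rewrite ler_pM2l.
  have : n * `|Y| <= n * cabs z by rewrite ler_pM2l.
  lra.
have h2 : `|expR X * sin Y - Y| <= 3 * n * cabs z.
  have -> : expR X * sin Y - Y = (expR X - 1) * Y + expR X * (sin Y - Y) by ring.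
  apply: le_trans (ler_normD _ _) _; rewrite !normrM.
  have : `|expR X| * `|sin Y - Y| <= 2 * (n * `|Y|) by apply: ler_pM.
  have : `|expR X - 1| * `|Y| <= n * `|Y| by apply: ler_wpM2r => //; exact: ltW.
  have : n * `|Y| <= n * cabs z by rewrite ler_pM2l.
  lra.
apply: le_lt_trans (cabs_le_ReIm _) _; rewrite !cReB !cImB /= subr0 -/X -/Y.
have nz : n * cabs z <= e / 7 * cabs z by rewrite ler_pM2r.
have ez : 0 < e * cabs z by rewrite mulr_gt0.
lra.
Qed.

Lemma CD_cexp z : CD (@cexp R) z (cexp z).
Proof.
have C1 : CD (fun x : CC R => x - z) z 1.
  by have := CDB (CD_id z) (CD_cst z z); rewrite subr0.
have := CDZ (cexp z) (CD_comp C1 (f := @cexp R) (e := 1) _); rewrite !mulr1.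
rewrite subrr => /(_ CD_cexp0); apply: CD_ext => x.
by rewrite -cexpD addrC subrK.
Qed.

Lemma cexp_two_pi_i_int (n : int) : cexp (two_pi_i R * n%:~R) = 1.
Proof.
have nat_case k : cexp (two_pi_i R * k%:R) = 1.
  elim: k => [|k IH]; first by rewrite mulr0 cexp0.
  rewrite -natr1 mulrDr cexpD IH mulr1 mul1r; apply: CC_eqP => /=.
    by rewrite expR0 mul1r mulr_natl cos2pi.
  by rewrite expR0 mul1r mulr_natl sin2pi.
case: n => k; first exact: nat_case.
rewrite NegzE mulrNz mulrN; have := cexpN (two_pi_i R * k.+1%:R).
by rewrite nat_case mul1r.
Qed.

Lemma two_pi_i_neq0 : two_pi_i R != 0.
Proof.
apply/eqP => /(congr1 (@complex.Im R)) /=; have := pi_gt0 R => p p0.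
by move: p0 p; lra.
Qed.

(** The modulus forces [z] to be real. Subtracting its floor leaves [t] in [[0, 1[], and
    [cos (2 pi t) = 1 - 2 sin (pi t)^2] gives [sin (pi t) = 0], hence [t = 0]. *)
Lemma cexp_eq1 z : cexp (two_pi_i R * z) = 1 -> exists n : int, z = n%:~R.
Proof.
have pi0 := pi_gt0 R.
move=> H; have := congr1 (@cabs R) H; rewrite cabs_cexp. rewrite cabs1 cReM /= mul0r sub0r.
rewrite -[RHS]expR0 => /expR_inj /eqP.
have p2 : 0 < 2 * pi :> R by rewrite mulr_gt0.
rewrite oppr_eq0 mulf_eq0 (gt_eqF p2) /= => /eqP z0; pose n := Num.floor (complex.Re z).
exists n; apply/eqP; rewrite -subr_eq0; set y := z - n%:~R.
have : cexp (two_pi_i R * y) = 1.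
  by rewrite /y mulrBr cexpD H -mulrN -mulrNz cexp_two_pi_i_int mulr1.
have nE : n%:~R = ofR n%:~R :> CC R by rewrite rmorph_int.
have y0 : complex.Im y = 0 by rewrite /y nE cImB z0 subrr.
have [yge ylt] : 0 <= complex.Re y /\ complex.Re y < 1.
  rewrite /y nE cReB /= subr_ge0 ltrBlDl; split; first exact: floor_le_tmp.
  by rewrite -intrD1 floorD1_gt.
move=> /(congr1 (@complex.Re R)) /=; rewrite !cReM !cImM /= y0 !(mul0r, mulr0) subrr expR0 mul1r add0r.
set t := complex.Re y in yge ylt *.
have -> : 2 * pi * t = (pi * t) *+ 2 by ring.
rewrite cos_mulr2n cos2sin2 => Hs.
have s0 : sin (pi * t) ^+ 2 = 0 by move: Hs; rewrite mulr2n; lra.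
move/eqP: s0; rewrite sqrf_eq0 => /eqP s0.
have t0 : t = 0.
  apply/eqP; apply: contraT => tn; have tp : 0 < t by rewrite lt_neqAle eq_sym tn.
  have : 0 < sin (pi * t) by apply: sin_gt0_pi; rewrite mulr_gt0//= gtr_pMr.
  by rewrite s0 ltxx.
by apply/eqP/CC_eqP.
Qed.

Lemma cexp_surj w : w != 0 -> exists z : CC R, cexp (two_pi_i R * z) = w.
Proof.
move=> w0; suff [u uw] : exists u : CC R, cexp u = w.
  by exists (u / two_pi_i R); rewrite mulrC divfK// two_pi_i_neq0.
have wp : 0 < cabs w by rewrite cabs_gt0.
pose x := complex.Re w / cabs w; pose y := complex.Im w / cabs w.
have xy : x ^+ 2 + y ^+ 2 = 1.
  by rewrite /x /y !exprMn -mulrDl -cabs_sqr exprVn divff// expf_neq0// gt_eqF.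
have x1 : -1 <= x <= 1.
  have := Re_le_cabs w; rewrite ler_norml /x ler_pdivrMr// ler_pdivlMr//.
  by rewrite mul1r mulN1r.
have ca : cos (acos x) = x by apply: acosK; rewrite in_itv /=.
have sa : sin (acos x) = `|y|.
  by rewrite sin_acos// -xy addrC addKr sqrtr_sqr.
(* [acos] only yields arguments in [[0, pi]], so the sign of the imaginary part selects the half
   plane. *)
exists (Complex (ln (cabs w)) (if 0 <= y then acos x else - acos x)).
have eE : expR (ln (cabs w)) = cabs w by apply: lnK; rewrite posrE.
apply: CC_eqP; rewrite /= eE.
  by case: ifP; rewrite ?cosN ca /x mulrC divfK// gt_eqF.
have -> : sin (if 0 <= y then acos x else - acos x) = y.
  case: ifPn => [y0|]; first by rewrite sa ger0_norm.
  by rewrite -ltNge => y0; rewrite sinN sa ltr0_norm// opprK.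
by rewrite /y mulrC divfK// gt_eqF.
Qed.

End ComplexExponential.

(** * Real derivatives and segments *)

Section RealDerivative.
Variable R : realType.

Lemma is_derive_slope (f g : R -> R) (t : R) : {for t, continuous g} ->
  (forall x, f x = f t + g x * (x - t)) -> is_derive t 1 f (g t).
Proof.
move=> gt fE.
have H : (fun h : R => h^-1 *: (f (h *: 1 + t) - f t)) @ 0^' --> g t.
  move=> A /gt /nbhs_ballP[r /= r0 Hr]; apply/nbhs_ballP.
  exists r => //= h; rewrite /ball /= sub0r normrN => hr h0.
  rewrite /= /GRing.scale /= mulr1 fE addrC addKr addrK mulrC mulfK//.
  by apply: Hr; rewrite /ball /= opprD addrCA subrr addr0 normrN.
split; first by apply/cvg_ex; exists (g t).
exact: cvg_lim H.
Qed.

Lemma is_derive_MVT (f d : R -> R) (a b : R) : a <= b ->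
  (forall t, a <= t <= b -> is_derive t 1 f (d t)) ->
  exists2 c, a <= c <= b & f b - f a = d c * (b - a).
Proof.
move=> ab H; have [||c] := @MVT_segment R f d a b ab.
- by move=> x; rewrite in_itv /= => /andP[/ltW ? /ltW ?]; apply: H; apply/andP.
- apply: derivable_within_continuous => x; rewrite in_itv /= => /H.
  by case.
by rewrite in_itv /= => ? ?; exists c.
Qed.

(* By Darboux's intermediate value property of derivatives. *)
Lemma darboux_gap (f d : R -> R) (a b e : R) : a < b -> 0 < e ->
  (forall t, a <= t <= b -> is_derive t 1 f (d t)) ->
  (forall t, a <= t <= b -> d t = 0 \/ e <= d t) ->
  (d a = 0 <-> d b = 0).
Proof.
move=> ab e0 fd gap.
(* Darboux: a minimum of [h] on the segment is interior, since [h] decreases at the left end and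
   increases towards the right end. *)
have key (h k : R -> R) (x y : R) : x < y -> (forall t, x <= t <= y -> is_derive t 1 h (k t)) ->
    k x < 0 -> 0 < k y -> exists2 c, x <= c <= y & k c = 0.
  move=> xy hk kx ky.
  have hc : {within `[x, y], continuous h}.
    apply: derivable_within_continuous => t; rewrite in_itv /= => /hk.
    by case.
  have [c /[!in_itv]/= cxy cmin] := EVT_min (ltW xy) hc.
  have approx t (txy : x <= t <= y) eps := @is_derive_approx R h t (k t) (hk t txy) eps.
  have cx : c != x.
    apply/eqP => cx.
    have xx : x <= x <= y by rewrite lexx ltW.
    have e1 : 0 < - k x / 2 by lra.
    have /nbhs_ballP[r /= r0 Hr] := approx x xx _ e1.
    pose s := Num.min (r / 2) (y - x).
    have s0 : 0 < s by rewrite lt_min divr_gt0//= subr_gt0.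
    have sr : s < r by rewrite /s gt_min; apply/orP; left; lra.
    have sy : x + s <= y by rewrite -lerBrDl ge_min lexx orbT.
    have := Hr (x + s); rewrite /ball /= opprD addrA subrr sub0r normrN gtr0_norm//.
    move=> /(_ sr).
    have := cmin (x + s); rewrite in_itv /= sy lerDl ltW//= cx => /(_ isT) cm.
    rewrite (_ : x + s - x = s); last by ring.
    rewrite [`|s|]gtr0_norm// ler_norml => /andP[_].
    have : k x * s < 0 by rewrite nmulr_rlt0.
    move: cm; nra.
  have cy : c != y.
    apply/eqP => cy.
    have yy : x <= y <= y by rewrite lexx ltW.
    have e1 : 0 < k y / 2 by lra.
    have /nbhs_ballP[r /= r0 Hr] := approx y yy _ e1.
    pose s := Num.min (r / 2) (y - x).
    have s0 : 0 < s by rewrite lt_min divr_gt0//= subr_gt0.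
    have sr : s < r by rewrite /s gt_min; apply/orP; left; lra.
    have sy : x <= y - s by rewrite lerBrDr -lerBrDl ge_min lexx orbT.
    have := Hr (y - s); rewrite /ball /= opprB addrC subrK gtr0_norm//.
    move=> /(_ sr).
    have := cmin (y - s); rewrite in_itv /= sy gerBl ltW//= cy => /(_ isT) cm.
    rewrite (_ : y - s - y = - s); last by ring.
    rewrite normrN [`|s|]gtr0_norm// ler_norml => /andP[_].
    have : 0 < k y * s by rewrite mulr_gt0.
    move: cm; nra.
  exists c => //; have /andP[xc cy'] := cxy.
  have coo : c \in `]x, y[%R by rewrite in_itv /= !lt_neqAle eq_sym cx xc cy cy'.
  have D0 : is_derive c 1 h 0.
    apply: (@derive1_at_min R h x y c (ltW xy)) => // t; rewrite in_itv /= => /andP[/ltW xt /ltW ty].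
      by have [] : is_derive t 1 h (k t) by apply: hk; apply/andP.
    by apply: cmin; rewrite in_itv /= xt ty.
  have Dk := hk c cxy.
  by rewrite -(@derive_val _ _ _ _ _ _ _ Dk) (@derive_val _ _ _ _ _ _ _ D0).
(* The value [e / 2] lies strictly inside the gap of [d]; subtracting the line of slope [e / 2]
   turns it into the zero derivative that [key] produces. *)
have lin (t : R) : is_derive t 1 (fun x : R => e / 2 * x) (e / 2).
  apply: (@is_derive_slope (fun x => e / 2 * x) (fun=> e / 2)) => [|x]; last by ring.
  exact: cst_continuous.
have aa : a <= a <= b by rewrite lexx ltW.
have bb : a <= b <= b by rewrite lexx ltW.
split => [da|db]; apply: contrapT => dn.
- have [c cab] : exists2 c, a <= c <= b & d c - e / 2 = 0.
    apply: (key (f - (fun x : R => e / 2 * x)) (fun t => d t - e / 2) _ _ ab).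
    + by move=> t /fd fdt; have lt := lin t; exact: is_deriveB.
    + by rewrite da; lra.
    + by case: (gap _ bb) => //; lra.
  by case: (gap _ cab) => H; lra.
- have [c cab] : exists2 c, a <= c <= b & e / 2 - d c = 0.
    apply: (key ((fun x : R => e / 2 * x) - f) (fun t => e / 2 - d t) _ _ ab).
    + by move=> t /fd fdt; have lt := lin t; exact: is_deriveB.
    + by case: (gap _ aa) => //; lra.
    + by rewrite db; lra.
  by case: (gap _ cab) => H; lra.
Qed.

End RealDerivative.

(** * Restriction to segments, and connectedness of the complement of a discrete set *)

Section Lines.
Variable R : realType.
Implicit Types (f : CC R -> CC R) (a b z u : CC R) (T V : CC R -> Prop).

Lemma continuous_line f a b (t : R) : {for a + ofR t * b, continuous f} ->
  {for t, continuous (fun s : R => f (a + ofR s * b))}.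
Proof.
move=> /continuous_CCP H; apply/continuous_RCP => e /H /near_CCP[d d0 Hd].
have b1 : 0 < cabs b + 1 by rewrite ltr_wpDl// cabs_ge0.
apply/nbhs_ballP; exists (d / (cabs b + 1)) => /=; first by rewrite divr_gt0.
move=> s; rewrite /ball /= ltr_pdivlMr// => st; apply: Hd.
have -> : a + ofR s * b - (a + ofR t * b) = ofR (s - t) * b by rewrite rmorphB; ring.
rewrite cabsM cabs_ofR distrC; apply: le_lt_trans st.
by apply: ler_wpM2l => //; rewrite lerDl.
Qed.

Lemma CD_line f a b u (t : R) d : CD f (a + ofR t * b) d ->
  is_derive t 1 (fun s : R => complex.Re (u * f (a + ofR s * b))) (complex.Re (u * d * b)).
Proof.
move=> [g gt [<- fE]].
apply: (@is_derive_slope _ _ (fun s : R => complex.Re (u * g (a + ofR s * b) * b))).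
  have H : {for t, continuous (fun s => u * g (a + ofR s * b) * b)}.
    apply: (@continuous_line (fun x => u * g x * b)).
    by apply: contM; [apply: contM; [exact: cont_cst|exact: gt]|exact: cont_cst].
  exact: (continuous_comp H (@continuous_Re R _)).
move=> s; rewrite fE mulrDr cReD; congr (_ + _).
have -> : u * (g (a + ofR s * b) * (a + ofR s * b - (a + ofR t * b))) =
  u * g (a + ofR s * b) * b * ofR (s - t) by rewrite rmorphB; ring.
by rewrite cReM /= mulr0 subr0.
Qed.

Lemma cabs_conj u : u * (conjc u : CC R) = ofR (cabs u ^+ 2).
Proof. by rewrite rmorphXn /= ofR_abs -sqr_normc. Qed.

Lemma cabs_conjc u : cabs (conjc u : CC R) = cabs u.
Proof. by rewrite /cabs normcJ. Qed.

(** Multiplication by the conjugate of the increment makes the increment real and nonnegative, so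
    the real mean value theorem applies to the real part. *)
Lemma mean_value f (d : R -> CC R) a b (M : R) :
  (forall t : R, 0 <= t <= 1 -> CD f (a + ofR t * (b - a)) (d t)) ->
  (forall t : R, 0 <= t <= 1 -> cabs (d t) <= M) ->
  cabs (f b - f a) <= M * cabs (b - a).
Proof.
move=> fd dM; have [->|fab] := eqVneq (f b - f a) 0.
  rewrite cabs0 mulr_ge0 ?cabs_ge0//; apply: le_trans (cabs_ge0 _) (dM 0 _).
  by rewrite lexx ler01.
have fab0 : 0 < cabs (f b - f a) by rewrite cabs_gt0.
pose u : CC R := conjc (f b - f a).
have H t : 0 <= t <= 1 -> _ := fun t01 => CD_line u (fd t t01).
have [c c01] := is_derive_MVT ler01 H.
rewrite rmorph0 rmorph1 mul0r addr0 mul1r (addrC a) subrK subr0 mulr1.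
rewrite -cReB -mulrBr mulrC cabs_conj /= => E.
rewrite -(ler_pM2l fab0) -expr2 E; apply: le_trans (ler_norm _) _.
apply: le_trans (Re_le_cabs _) _; rewrite !cabsM cabs_conjc -mulrA ler_pM2l//.
by rewrite ler_wpM2r ?cabs_ge0// dM.
Qed.

(** Along the segment the indicator function of [T] is a real function with derivative 0, so the
    mean value theorem makes it constant. *)
Lemma segment_locally_constant T a b :
  (forall t : R, 0 <= t <= 1 -> exists2 r : R, 0 < r &
     (forall x, cabs (x - (a + ofR t * (b - a))) < r -> T x) \/
     (forall x, cabs (x - (a + ofR t * (b - a))) < r -> ~ T x)) ->
  T a -> T b.
Proof.
move=> loc Ta; pose f (t : R) : R := `[< T (a + ofR t * (b - a)) >]%:R.
have H (t : R) : 0 <= t <= 1 -> is_derive t 1 f 0.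
  move=> /loc[r r0 Hr]; apply: (@near_eq_is_derive _ _ _ (cst (f t))).
  have : {for t, continuous (fun s => id (a + ofR s * (b - a)))}.
    by apply: (@continuous_line id); exact: cont_id.
  move=> /continuous_RCP/(_ _ r0); have := Hr; rewrite -/(a + ofR t * (b - a)).
  case=> HT; apply: filterS => s /= /HT Ts.
    have Tt : T (a + ofR t * (b - a)) by apply: HT; rewrite subrr cabs0.
    by rewrite /f !asboolT.
  have Tt : ~ T (a + ofR t * (b - a)) by apply: HT; rewrite subrr cabs0.
  by rewrite /f !asboolF.
have [c _] := is_derive_MVT ler01 H.
rewrite mul0r /f rmorph0 rmorph1 mul0r addr0 mul1r (addrC a) subrK (asboolT Ta) => /eqP.
by rewrite subr_eq0 eqr_nat; case: asboolP.
Qed.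

(** Equivalently, the complement of [V] has no accumulation point in the plane. *)
Definition cofinite_locally V := forall z, exists2 r : R, 0 < r &
  forall x, x != z -> cabs (x - z) < r -> V x.

Definition locally_constant_on V T := forall z, V z -> exists2 r : R, 0 < r &
     (forall x, cabs (x - z) < r -> T x) \/ (forall x, cabs (x - z) < r -> ~ T x).

(** A segment inside the disc can meet [z] only if [x], [y] and [z] are collinear, that is, if
    [rho = (y - z) / (x - z)] is real. In that case the path turns at [m], obtained from [x] by a
    quarter turn about [z]. *)
Lemma punctured_disc_const V T z (r : R) :
  (forall x, x != z -> cabs (x - z) < r -> V x) -> locally_constant_on V T ->
  forall x y, x != z -> cabs (x - z) < r -> y != z -> cabs (y - z) < r -> T x -> T y.
Proof.
move=> Vr loc.
have seg x y : (forall t : R, 0 <= t <= 1 -> x + ofR t * (y - x) != z) ->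
    cabs (x - z) < r -> cabs (y - z) < r -> T x -> T y.
  move=> avoid xr yr; apply: segment_locally_constant => t t01.
  apply: loc; apply: Vr; first exact: avoid.
  have -> : x + ofR t * (y - x) - z = ofR (1 - t) * (x - z) + ofR t * (y - z).
    by rewrite rmorphB rmorph1; ring.
  apply: le_lt_trans (cabsD _ _) _; rewrite !cabsM !cabs_ofR.
  have /andP[t0 t1] := t01; rewrite !ger0_norm ?subr_ge0//.
  have [t_|t_] := eqVneq t 0; first by rewrite t_ mul0r addr0 subr0 mul1r.
  have : t * cabs (y - z) < t * r by rewrite ltr_pM2l// lt_neqAle eq_sym t_.
  have : (1 - t) * cabs (x - z) <= (1 - t) * r.
    by rewrite ler_wpM2l ?subr_ge0// ltW.
  lra.
move=> x y xz xr yz yr Tx.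
have xz0 : x - z != 0 by rewrite subr_eq0.
have yz0 : y - z != 0 by rewrite subr_eq0.
have [rho yE] : exists rho, y = z + (x - z) * rho.
  by exists ((y - z) / (x - z)); field.
have [im0|im] := eqVneq (complex.Im rho) 0; last first.
  apply: seg xr yr Tx => t /andP[t0 t1]; apply/eqP => E.
  have /eqP : (x - z) * (1 - ofR t + ofR t * rho) = 0.
    by rewrite -(subrr z) -{2}E [in RHS]yE; ring.
  rewrite mulf_eq0 (negbTE xz0) /= => /eqP E2.
  have := congr1 (@complex.Im R) E2.
  rewrite cImD cImB cImM /= mul0r addr0 subrr add0r => /eqP.
  rewrite mulf_eq0 (negbTE im) orbF => /eqP t_.
  by move: E2 => /eqP; rewrite t_ rmorph0 mul0r addr0 subr0 oner_eq0.
pose i : CC R := Complex 0 1.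
pose m := z + i * (x - z).
have mr : cabs (m - z) < r.
  rewrite /m addrC addKr cabsM (_ : cabs i = 1) ?mul1r//.
  by apply/eqP; rewrite -(@eqrXn2 _ 2) ?cabs_ge0// cabs_sqr /= expr0n /= !expr1n add0r.
have Tm : T m.
  apply: seg xr mr Tx => t /andP[t0 t1]; apply/eqP => E.
  have /eqP : (x - z) * (1 - ofR t + ofR t * i) = 0.
    by rewrite -(subrr z) -{2}E /m; ring.
  rewrite mulf_eq0 (negbTE xz0) /= => /eqP E2.
  have := congr1 (@complex.Im R) E2; have := congr1 (@complex.Re R) E2.
  rewrite cReD cImD cImB cReB cImM cReM /= => E3 E4.
  by move: E3 E4; lra.
apply: seg mr yr Tm => t /andP[t0 t1]; apply/eqP => E.
have /eqP : (x - z) * (ofR (1 - t) * i + ofR t * rho) = 0.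
  rewrite -(subrr z) -{2}E /m [in RHS]yE rmorphB rmorph1; ring.
rewrite mulf_eq0 (negbTE xz0) /= => /eqP E2.
have := congr1 (@complex.Im R) E2; have := congr1 (@complex.Re R) E2.
rewrite cReD cImD !cImM !cReM /= im0 => E3 E4.
have t_ : t = 1 by move: E4; lra.
have re0 : complex.Re rho = 0 by move: E3; rewrite t_; lra.
have rho0 : rho = 0 by exact: CC_eqP.
by move: yz; rewrite yE rho0 mulr0 addr0 eqxx.
Qed.

Lemma locally_constant_global V T : cofinite_locally V -> locally_constant_on V T ->
  forall x y, V x -> V y -> T x -> T y.
Proof.
move=> Viso loc x y Vx Vy Tx.
(* [T'] extends [T] across the points outside [V]. It is locally constant at every point of the
   plane, so it may be followed along the straight segment from [x] to [y] even where that segment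
   leaves [V]. *)
pose T' z := exists2 r : R, 0 < r & forall x, x != z -> cabs (x - z) < r -> T x.
have pt z (r : R) : 0 < r -> exists2 u, u != z & cabs (u - z) < r.
  move=> r0; exists (z + ofR (r / 2)).
    rewrite -subr_eq0 addrC addKr -(rmorph0 (@ofR R)) (inj_eq (@ofRI R)).
    by rewrite gt_eqF// divr_gt0.
  by rewrite addrC addKr cabs_ofR gtr0_norm ?divr_gt0//; lra.
have T'x : T' x.
  have [r r0 [H|H]] := loc x Vx; first by exists r => // u _; exact: H.
  by have := H x; rewrite subrr cabs0 => /(_ r0).
have T'y : T' y.
  move: T'x; apply: segment_locally_constant => t _; set z := x + _.
  have [r r0 Hr] := Viso z; exists r => //.
  have [[u [uz ur Tu]]|none] := pselect (exists u, [/\ u != z, cabs (u - z) < r & T u]).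
    left=> v vr; have Tr := punctured_disc_const Hr loc uz ur _ _ Tu.
    have [->|vz] := eqVneq v z; first by exists r => // k kz kr; exact: Tr.
    have s0 : 0 < Num.min (r - cabs (v - z)) (cabs (v - z)).
      by rewrite lt_min subr_gt0 vr cabs_gt0 subr_eq0.
    exists (Num.min (r - cabs (v - z)) (cabs (v - z))) => // k kv.
    rewrite lt_min => /andP[k1 k2]; apply: Tr.
      by apply: contraTneq k2 => ->; rewrite -leNgt cabsC.
    have -> : k - z = (k - v) + (v - z) by ring.
    by apply: le_lt_trans (cabsD _ _) _; rewrite -ltrBrDr.
  right=> v vr [s s0 Hs]; apply: none.
  have s'0 : 0 < Num.min s (r - cabs (v - z)) by rewrite lt_min s0 subr_gt0.
  have [vz|vz] := eqVneq v z.
    have [u uv] := pt v _ s'0; rewrite lt_min => /andP[u1 u2].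
    exists u; rewrite -vz; split => //; last exact: Hs.
    by move: u2; rewrite vz subrr cabs0 subr0.
  have s2 : 0 < Num.min (Num.min s (r - cabs (v - z))) (cabs (v - z)).
    by rewrite lt_min s'0 cabs_gt0 subr_eq0.
  have [u uv] := pt v _ s2; rewrite !lt_min => /andP[/andP[u1 u2] u3].
  exists u; split; last exact: Hs.
    by apply: contraTneq u3 => ->; rewrite -leNgt cabsC.
  have -> : u - z = (u - v) + (v - z) by ring.
  by apply: le_lt_trans (cabsD _ _) _; rewrite -ltrBrDr.
have [r r0 [H|H]] := loc y Vy; first by apply: H; rewrite subrr cabs0.
have [s s0 Hs] := T'y.
have m0 : 0 < Num.min r s by rewrite lt_min r0.
have [u uy] := pt y _ m0; rewrite lt_min => /andP[u1 u2].
by case: (H u u1); exact: Hs.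
Qed.

End Lines.

(** * Exponential polynomials *)

Section ExpPoly.
Variable R : realType.
Implicit Types (f : CC R -> CC R) (a b z u : CC R) (A B : {poly CC R})
  (p : {poly CC R} * {poly CC R}).

(** A zero of exact order [j] with leading coefficient [alpha]. No power series is involved: the
    cofactor is only required to be continuous. *)
Definition ord_at f z (j : nat) (alpha : CC R) :=
  alpha != 0 /\ exists2 g : CC R -> CC R, {for z, continuous g} &
    g z = alpha /\ forall x, f x = (x - z) ^+ j * g x.

Lemma ord_at0 f z : {for z, continuous f} -> f z != 0 -> ord_at f z 0 (f z).
Proof.
by move=> fz f0; split=> //; exists f; [exact: fz|split=> // x; rewrite mul1r].
Qed.

Lemma near_CC_min z (P Q : CC R -> Prop) :
  (\forall x \near z, P x) -> (\forall x \near z, Q x) ->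
  exists2 r : R, 0 < r & forall x, cabs (x - z) < r -> P x /\ Q x.
Proof.
move=> /near_CCP[r r0 Hr] /near_CCP[s s0 Hs].
exists (Num.min r s); first by rewrite lt_min r0.
by move=> x; rewrite lt_min => /andP[/Hr ? /Hs ?].
Qed.

Lemma ord_at_isolated f z j alpha : ord_at f z j alpha ->
  exists2 r : R, 0 < r & forall x, x != z -> cabs (x - z) < r -> f x != 0.
Proof.
move=> [a0 [g gz [ga fE]]].
have /near_CCP[r r0 Hr] : \forall x \near z, g x != 0.
  by apply: cont_near_neq0 gz _; rewrite ga.
exists r => // x xz /Hr gx; rewrite fE mulf_neq0// expf_neq0// subr_eq0//.
Qed.

Lemma ord_at_CD f z alpha d : ord_at f z 1 alpha -> CD f z d -> d = alpha.
Proof.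
move=> [a0 [g gz [ga fE]]] Cf; apply: CD_uniq Cf _.
exists g => //; split => // x; rewrite !fE subrr expr1 expr0n /= mul0r add0r.
by rewrite mulrC.
Qed.

Lemma CD_shiftX z x n : CD (fun y : CC R => (y - z) ^+ n.+1) x (n.+1%:R * (x - z) ^+ n).
Proof.
elim: n => [|n IH].
  have := CDB (CD_id x) (CD_cst z x); rewrite subr0 mulr1.
  by apply: CD_ext => y; rewrite expr1.
have C1 : CD (fun y : CC R => y - z) x 1.
  by have := CDB (CD_id x) (CD_cst z x); rewrite subr0.
have := CDM C1 IH.
have -> : 1 * (x - z) ^+ n.+1 + (x - z) * (n.+1%:R * (x - z) ^+ n) =
  n.+2%:R * (x - z) ^+ n.+1 by rewrite exprS -(natr1 n.+1); ring.
by apply: CD_ext => y; rewrite [in RHS]exprS.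
Qed.

(** The mean value inequality is applied to [k], which is [f] minus its expected leading term: its
    derivative is [(y - z)^j] times a factor that tends to 0. *)
Lemma ord_at_prim f f' z j alpha : (forall x, CD f x (f' x)) -> f z = 0 ->
  ord_at f' z j alpha -> ord_at f z j.+1 (alpha / j.+1%:R).
Proof.
move=> Cf fz [a0 [g' g'z [ga f'E]]].
have j0 : j.+1%:R != 0 :> CC R by rewrite pnatr_eq0.
split; first by rewrite mulf_neq0// invr_eq0.
exists (fun x => if x == z then alpha / j.+1%:R else f x / (x - z) ^+ j.+1); last first.
  split=> [|x]; first by rewrite eqxx.
  case: eqVneq => [->|xz]; first by rewrite subrr expr0n /= mul0r fz.
  by rewrite mulrC divfK// expf_neq0// subr_eq0.
apply/continuous_CCP => e e0; rewrite eqxx.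
have e20 : 0 < e / 2 by rewrite divr_gt0.
have /continuous_CCP/(_ _ e20)/near_CCP[r r0 Hr] := g'z.
apply/near_CCP; exists r => // x xr.
case: eqVneq => [_|xz]; first by rewrite subrr cabs0.
have xz0 : x - z != 0 by rewrite subr_eq0.
have xz1 : 0 < cabs (x - z) by rewrite cabs_gt0.
pose k y := f y - alpha / j.+1%:R * (y - z) ^+ j.+1.
have kz : k z = 0 by rewrite /k fz subrr expr0n /= mulr0 subrr.
have Ck y : CD k y ((y - z) ^+ j * (g' y - alpha)).
  have := CDB (Cf y) (CDZ (alpha / j.+1%:R) (CD_shiftX z y j)).
  rewrite f'E; set D := (_ - _); set D' := _ * (g' y - alpha).
  have -> : D = D' by rewrite /D /D'; field.
  exact.
have seg t : 0 <= t <= 1 -> cabs (z + ofR t * (x - z) - z) <= cabs (x - z).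
  move=> /andP[t0 t1]; rewrite addrC addKr cabsM cabs_ofR ger0_norm//.
  by rewrite ler_piMl// cabs_ge0.
have := @mean_value R k _ z x (cabs (x - z) ^+ j * (e / 2)) (fun t _ => Ck _).
rewrite kz subr0 => kx.
have {}kx : cabs (k x) <= cabs (x - z) ^+ j * (e / 2) * cabs (x - z).
  apply: kx => t t01; rewrite cabsM cabsX; apply: ler_pM.
  - by rewrite exprn_ge0// cabs_ge0.
  - exact: cabs_ge0.
  - by apply: lerXn2r; rewrite ?nnegrE ?cabs_ge0// seg.
  - rewrite -ga; apply/ltW/Hr; apply: le_lt_trans xr; exact: seg.
have -> : f x / (x - z) ^+ j.+1 - alpha / j.+1%:R = k x / (x - z) ^+ j.+1.
  by rewrite /k mulrBl mulfK// expf_neq0.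
rewrite cabsM cabsV cabsX ltr_pdivrMr ?exprn_gt0//.
apply: le_lt_trans kx _; rewrite exprSr mulrAC mulrC ltr_pM2r ?mulr_gt0 ?exprn_gt0//.
by lra.
Qed.

Definition wexp z := cexp (two_pi_i R * z).

Lemma wexp_neq0 z : wexp z != 0. Proof. exact: cexp_neq0. Qed.

Lemma CD_wexp z : CD wexp z (two_pi_i R * wexp z).
Proof.
have := CD_comp (CDZ (two_pi_i R) (CD_id z)) (CD_cexp (two_pi_i R * z)).
by rewrite mulr1 mulrC.
Qed.

Lemma wexp_period z (n : nat) : wexp (z + n%:R) = wexp z.
Proof. by rewrite /wexp mulrDr cexpD (cexp_two_pi_i_int R n) mulr1. Qed.

(** This is [d/dz] acting on polynomials in [w]; the monomial [w^i] is an eigenvector for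
    [2 pi i * i]. *)
Definition theta A := two_pi_i R *: ('X * A^`()).

Lemma CD_horner_wexp A z : CD (fun x => A.[wexp x]) z (theta A).[wexp z].
Proof.
have := CD_comp (CD_wexp z) (CD_horner A (wexp z)).
by rewrite /theta hornerZ hornerM hornerX [_.[_] * _]mulrC mulrA.
Qed.

Lemma coef_theta A i : (theta A)`_i = two_pi_i R * i%:R * A`_i.
Proof.
rewrite /theta coefZ coefXM; case: i => [|i]; first by rewrite /= !(mulr0, mul0r).
by rewrite coef_deriv /= -[A`_i.+1 *+ _]mulr_natl mulrA.
Qed.

Definition epoly p z := z * p.1.[wexp z] + p.2.[wexp z].

Definition eder p := (theta p.1, p.1 + theta p.2).

Lemma CD_epoly p z : CD (epoly p) z (epoly (eder p) z).
Proof.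
have := CDD (CDM (CD_id z) (CD_horner_wexp p.1 z)) (CD_horner_wexp p.2 z).
rewrite /epoly /eder /= hornerD mul1r; set D := (_ + _); set D' := (_ + _).
have -> : D = D' by rewrite /D /D'; ring.
exact.
Qed.

(** The operator [d/dz - lam] on coefficient pairs. For [lam = 2 pi i n], it kills [w^n], and its
    square also kills [z w^n]. *)
Definition etwist lam p :=
  (theta p.1 - lam *: p.1, p.1 + theta p.2 - lam *: p.2).

Lemma thetaD A B : theta (A + B) = theta A + theta B.
Proof. by rewrite /theta derivD mulrDr scalerDr. Qed.
Lemma thetaZ a A : theta (a *: A) = a *: theta A.
Proof. by rewrite /theta derivZ -scalerAr !scalerA mulrC. Qed.
Lemma thetaB A B : theta (A - B) = theta A - theta B.
Proof. by rewrite thetaD -scaleN1r thetaZ scaleN1r. Qed.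

Lemma eder_twist lam p : eder (etwist lam p) = etwist lam (eder p).
Proof.
rewrite /eder /etwist /=; congr (_, _); first by rewrite thetaB (thetaZ lam).
rewrite thetaB (thetaZ lam) thetaD scalerDr.
ring.
Qed.

Lemma iter_eder_twist lam p j :
  iter j eder (etwist lam p) = etwist lam (iter j eder p).
Proof. by elim: j => //= j ->; rewrite eder_twist. Qed.

Lemma epoly_twist lam p z : epoly (etwist lam p) z = epoly (eder p) z - lam * epoly p z.
Proof. by rewrite /epoly /etwist /eder /= !(hornerD, hornerN, hornerZ); ring. Qed.

Definition eflat z p := forall j, epoly (iter j eder p) z = 0.

Lemma eflat_twist lam z p : eflat z p -> eflat z (etwist lam p).
Proof.
by move=> H j; rewrite iter_eder_twist epoly_twist -iterS !H mulr0 subr0.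
Qed.

(** Let [n] be the largest exponent allowed. Two twists by [2 pi i n] remove it, so the induction
    hypothesis makes the twisted pair zero; on every other exponent [i] they act through the nonzero
    factor [(2 pi i (i - n))^2], so only [a z w^n + b w^n] is left. One twist turns this into
    [a w^n], whose vanishing at [z] gives [a = 0], and then [b = 0]. *)
Lemma eflat_eq0 z n p : (size p.1 <= n)%N -> (size p.2 <= n)%N -> eflat z p ->
  p.1 = 0 /\ p.2 = 0.
Proof.
elim: n p => [|n IH] p.
  by rewrite !leqn0 !size_poly_eq0 => /eqP -> /eqP ->.
move=> s1 s2 flat; pose lam := two_pi_i R * n%:R.
have tpi := two_pi_i_neq0 R.
have c1 i : (etwist lam (etwist lam p)).1`_i = (two_pi_i R * (i%:R - n%:R)) ^+ 2 * p.1`_i.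
  by rewrite /etwist /= !(coefB, coefD, coef_theta, coefZ) /lam; ring.
have c2 i : (etwist lam (etwist lam p)).2`_i = (two_pi_i R * (i%:R - n%:R)) ^+ 2 * p.2`_i
    + 2 * (two_pi_i R * (i%:R - n%:R)) * p.1`_i.
  by rewrite /etwist /= !(coefB, coefD, coefN, coef_theta, coefZ) /lam; ring.
have [z1 z2] : (etwist lam (etwist lam p)).1 = 0 /\ (etwist lam (etwist lam p)).2 = 0.
  apply: IH; last by do 2 apply: eflat_twist.
    apply/leq_sizeP => i ni; rewrite c1; move: ni; rewrite leq_eqVlt => /predU1P[->|ni].
      by rewrite subrr mulr0 expr0n /= mul0r.
    by rewrite nth_default ?mulr0//; exact: leq_trans ni.
  apply/leq_sizeP => i ni; rewrite c2; move: ni; rewrite leq_eqVlt => /predU1P[->|ni].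
    by rewrite subrr mulr0 expr0n /= mul0r mulr0 mul0r addr0.
  by rewrite !nth_default ?mulr0 ?addr0//; [exact: leq_trans ni|exact: leq_trans ni].
have in0 i : i != n -> (two_pi_i R * (i%:R - n%:R)) ^+ 2 != 0.
  by move=> i_n; rewrite expf_neq0// mulf_neq0// subr_eq0 eqr_nat.
have A0 i : i != n -> p.1`_i = 0.
  move=> i_n; have := c1 i; rewrite z1 coef0 => /esym/eqP.
  by rewrite mulf_eq0 (negbTE (in0 _ i_n)) => /eqP.
have B0 i : i != n -> p.2`_i = 0.
  move=> i_n; have := c2 i; rewrite z2 coef0 (A0 _ i_n) mulr0 addr0 => /esym/eqP.
  by rewrite mulf_eq0 (negbTE (in0 _ i_n)) => /eqP.
have AE : p.1 = p.1`_n *: 'X^n.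
  apply/polyP => i; rewrite coefZ coefXn; case: eqVneq => [->|/A0 ->].
    by rewrite mulr1.
  by rewrite mulr0.
have BE : p.2 = p.2`_n *: 'X^n.
  apply/polyP => i; rewrite coefZ coefXn; case: eqVneq => [->|/B0 ->].
    by rewrite mulr1.
  by rewrite mulr0.
have wn : wexp z ^+ n != 0 by rewrite expf_neq0// wexp_neq0.
have a0 : p.1`_n = 0.
  have := eflat_twist lam flat 0%N; rewrite /= /epoly /etwist /=.
  have -> : theta p.1 - lam *: p.1 = 0.
    apply/polyP => i; rewrite coefB coef_theta coefZ coef0 /lam.
    by have [->|/A0 ->] := eqVneq i n; ring.
  have -> : p.1 + theta p.2 - lam *: p.2 = p.1.
    apply/polyP => i; rewrite coefB coefD coef_theta coefZ /lam.
    by have [->|/B0 ->] := eqVneq i n; ring.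
  rewrite horner0 mulr0 add0r AE hornerZ hornerXn => /eqP.
  by rewrite mulf_eq0 (negbTE wn) orbF coefZ coefXn eqxx mulr1 => /eqP.
have b0 : p.2`_n = 0.
  have := flat 0%N; rewrite /= /epoly AE a0 scale0r horner0 mulr0 add0r.
  rewrite BE hornerZ hornerXn => /eqP.
  by rewrite mulf_eq0 (negbTE wn) orbF coefZ coefXn eqxx mulr1 => /eqP.
by rewrite AE BE a0 b0 !scale0r.
Qed.

(** By [eflat_eq0] some derivative is nonzero at [z], where it has order 0; [ord_at_prim] climbs
    back to the function, each vanishing derivative raising the order by one. *)
Lemma ord_at_epoly p z : p.1 != 0 \/ p.2 != 0 ->
  exists j alpha, ord_at (epoly p) z j alpha.
Proof.
move=> p0; have [j Hj] : exists j, epoly (iter j eder p) z != 0.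
  apply: contrapT => H; have flat : eflat z p.
    by move=> j; apply/eqP; apply: contraT => Hj; case: H; exists j.
  have [] := @eflat_eq0 z (maxn (size p.1) (size p.2)) p _ _ flat.
  - exact: leq_maxl.
  - exact: leq_maxr.
  by move=> q1 q2; case: p0; rewrite ?q1 ?q2 eqxx.
elim: j p Hj {p0} => [|j IH] p Hj.
  by exists 0%N, (epoly p z); apply: ord_at0 => //; apply: CD_continuous (CD_epoly p z).
have [pz|pz] := eqVneq (epoly p z) 0; last first.
  by exists 0%N, (epoly p z); apply: ord_at0 => //; apply: CD_continuous (CD_epoly p z).
move: Hj; rewrite iterSr => /IH[k [al Hk]].
by exists k.+1, (al / k.+1%:R); apply: ord_at_prim (CD_epoly p) pz Hk.
Qed.

End ExpPoly.

(** * Linear equations off a discrete set *)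

Section LinearODE.
Variable R : realType.
Implicit Types (F G k : CC R -> CC R) (z u : CC R) (V : CC R -> Prop).

Lemma cofinite_point V z (r : R) : cofinite_locally V -> 0 < r ->
  exists2 x, V x & cabs (x - z) < r.
Proof.
move=> /(_ z)[s s0 Hs] r0; pose m := Num.min r s / 2.
have m0 : 0 < m by rewrite divr_gt0// lt_min r0.
have : m < Num.min r s.
  by rewrite /m ltr_pdivrMr// ltr_pMr ?ltr1n// lt_min r0.
rewrite lt_min => /andP[mr ms].
have xz : z + ofR m - z = ofR m by rewrite addrC addKr.
exists (z + ofR m); last by rewrite xz cabs_ofR gtr0_norm.
apply: Hs; last by rewrite xz cabs_ofR gtr0_norm.
by rewrite -subr_eq0 xz -(rmorph0 (@ofR R)) (inj_eq (@ofRI R)) gt_eqF.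
Qed.

Lemma cofinite_eq V F G : cofinite_locally V ->
  (forall z, {for z, continuous F}) -> (forall z, {for z, continuous G}) ->
  (forall z, V z -> F z = G z) -> F =1 G.
Proof.
move=> Vc Fc Gc FG z; apply/eqP; rewrite -subr_eq0; apply: contraT => d0.
have FGc : {for z, continuous (fun x => F x - G x)}.
  by apply: contD; [exact: Fc|apply: contN; exact: Gc].
have /near_CCP[r r0 Hr] := cont_near_neq0 FGc d0.
have [x Vx xr] := cofinite_point z Vc r0.
by have := Hr x xr; rewrite FG// subrr eqxx.
Qed.

Lemma ball_segment z x (r t : R) : 0 <= t <= 1 -> cabs (x - z) < r ->
  cabs (z + ofR t * (x - z) - z) < r.
Proof.
move=> /andP[t0 t1]; apply: le_lt_trans; rewrite addrC addKr cabsM cabs_ofR.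
by rewrite ger0_norm// ler_piMl// cabs_ge0.
Qed.

Lemma CD0_ball_const F z (r : R) : (forall x, cabs (x - z) < r -> CD F x 0) ->
  forall x, cabs (x - z) < r -> F x = F z.
Proof.
move=> F0 x xr.
have := @mean_value R F (fun=> 0) z x 0.
rewrite mul0r => H; apply/eqP; rewrite -subr_eq0 -cabs_eq0 eq_le cabs_ge0 andbT.
apply: H => t t01; last by rewrite cabs0.
by apply: F0; exact: ball_segment.
Qed.

Lemma CD0_cofinite_const V F : cofinite_locally V ->
  (forall z, V z -> \forall x \near z, V x) ->
  (forall z, V z -> CD F z 0) -> forall x y, V x -> V y -> F y = F x.
Proof.
move=> Vc Vo F0 x y Vx Vy.
apply: (@locally_constant_global R V (fun z => F z = F x) Vc _ x y Vx Vy erefl).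
move=> z /Vo/near_CCP[r r0 Hr]; exists r => //.
have H := @CD0_ball_const F z r (fun x xr => F0 x (Hr x xr)).
have [E|E] := pselect (F z = F x); [left|right] => u ur; rewrite (H u ur)//.
Qed.

(** Near [z] the second alternative puts [F'] close to [F z * k z], which is not 0. Hence along a
    short segment [F'] would have to jump in order to change alternative, and [darboux_gap] forbids
    this. *)
Lemma derivative_choice_local F F' k z (r : R) :
  (forall x, CD F x (F' x)) -> {for z, continuous F} ->
  {for z, continuous k} -> F z != 0 -> k z != 0 -> 0 < r ->
  (forall x, cabs (x - z) < r -> F' x = 0 \/ F' x = F x * k x) ->
  exists2 s : R, 0 < s <= r & forall x, cabs (x - z) < s -> (F' z = 0 <-> F' x = 0).
Proof.
move=> CF Fz kz F0 k0 r0 ch.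
pose g x := F x * k x; have gc : {for z, continuous g} by apply: contM.
have g0 : g z != 0 by rewrite mulf_neq0.
have ga : 0 < cabs (g z) by rewrite cabs_gt0.
have e0 : 0 < cabs (g z) / 2 by rewrite divr_gt0.
have /continuous_CCP/(_ _ e0)/near_CCP[q q0 Hq] := gc.
exists (Num.min q r); first by rewrite lt_min q0 r0 ge_min lexx orbT.
move=> x; have [->//|xz] := eqVneq x z.
rewrite lt_min => /andP[xq xr]; pose b := x - z.
have b0 : 0 < cabs b by rewrite cabs_gt0 subr_eq0.
(* With this factor the derivative of [Re (u F)] along the segment is [cabs (g z * b) ^+ 2] up to an
   error of at most half of it, whenever [F' = F k]; hence the gap [e]. *)
pose u : CC R := conjc (g z * b).
pose d t := complex.Re (u * F' (z + ofR t * b) * b).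
pose e := (cabs b * cabs (g z)) ^+ 2 / 2.
have ee : 0 < e by rewrite divr_gt0// exprn_gt0// mulr_gt0.
have gap t : 0 <= t <= 1 -> (F' (z + ofR t * b) = 0 /\ d t = 0) \/
    (F' (z + ofR t * b) != 0 /\ e <= d t).
  move=> t01; have yr := ball_segment t01 xr; have yq := ball_segment t01 xq.
  case: (ch _ yr) => E; first by left; rewrite /d E mulr0 mul0r.
  right; suff de : e <= d t.
    split=> //; apply/eqP => F'0; move: de; rewrite /d F'0 mulr0 mul0r /=; lra.
  rewrite /d E -/(g _); set y := z + _ in yr yq *.
  have -> : u * g y * b = (g z * b) * u + u * (g y - g z) * b by ring.
  rewrite cReD cabs_conj /= cabsM mulrC.
  have : `|complex.Re (u * (g y - g z) * b)| <= e.
    apply: le_trans (Re_le_cabs _) _; rewrite !cabsM cabs_conjc cabsM /e.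
    have : cabs (g y - g z) <= cabs (g z) / 2 by apply/ltW/Hq.
    move=> H; apply: (@le_trans _ _ (cabs (g z) * cabs b * (cabs (g z) / 2) * cabs b)).
      by rewrite ler_pM2r// ler_wpM2l// mulr_ge0// ltW.
    by rewrite le_eqVlt; apply/orP; left; apply/eqP; field.
  by rewrite ler_norml /e mulrC => /andP[]; lra.
have [D1 D2] : d 0 = 0 <-> d 1 = 0.
  apply: (@darboux_gap R (fun s => complex.Re (u * F (z + ofR s * b))) d 0 1 e) => //.
    by move=> t _; exact: CD_line.
  by move=> t /gap[[_ ->]|[_ ?]]; [left|right].
have xE : z + ofR 1 * b = x by rewrite rmorph1 mul1r /b addrC subrK.
have zE : z + ofR 0 * b = z by rewrite rmorph0 mul0r addr0.
have G0 := gap 0; have G1 := gap 1; rewrite zE in G0; rewrite xE in G1.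
have := G0; rewrite lexx ler01 => /(_ isT) {}G0.
have := G1; rewrite lexx ler01 => /(_ isT) {}G1.
split=> E0.
  case: G0 => [[_ /D1 d1]|[/eqP//]].
  by case: G1 => [[]//|[_ H]]; exfalso; move: H; rewrite d1; lra.
case: G1 => [[_ /D2 d1]|[/eqP//]].
by case: G0 => [[]//|[_ H]]; exfalso; move: H; rewrite d1; lra.
Qed.

Lemma derivative_choice V F F' k :
  cofinite_locally V -> (forall z, V z -> \forall x \near z, V x) ->
  (forall x, CD F x (F' x)) ->
  (forall z, V z -> {for z, continuous k}) -> (forall z, V z -> k z != 0) ->
  (forall z, V z -> F' z = 0 \/ F' z = F z * k z) ->
  (exists z0, F z0 = 0) -> forall z, V z -> F' z = F z * k z.
Proof.
move=> Vc Vo CF kc k0 ch [z0 Fz0] z1 Vz1; apply: contrapT => bad.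
have F'1 : F' z1 = 0 by case: (ch z1 Vz1).
have v0 : F z1 != 0 by apply: contra_notN bad => /eqP ->; rewrite F'1 mul0r.
have Fc z : {for z, continuous F} by exact: CD_continuous (CF z).
(* Fixing the value of [F] keeps it away from 0, as [derivative_choice_local] requires, and where
   [F' = 0] near a point this value persists. *)
pose T z := F z = F z1 /\ F' z = 0.
have Tall z : V z -> T z.
  move=> Vz; apply: (@locally_constant_global R V T Vc _ z1 z Vz1 Vz) => // y Vy.
  move: y Vy => {Vz}{}z Vz.
  have [Fz|Fz] := eqVneq (F z) (F z1); last first.
    have dc : {for z, continuous (fun x => F x - F z1)}.
      by apply: contD; [exact: Fc|exact: cont_cst].
    have := cont_near_neq0 dc; rewrite subr_eq0 => /(_ Fz)/near_CCP[r r0 Hr].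
    exists r => //; right => x /Hr; rewrite subr_eq0 => /eqP Fx [].
    by move=> /Fx.
  have /near_CCP[r r0 Hr] := Vo z Vz.
  have Fz0' : F z != 0 by rewrite Fz.
  have [s /andP[s0 sr] Hs] := derivative_choice_local CF (Fc z) (kc z Vz) Fz0' (k0 z Vz) r0
    (fun x xr => ch x (Hr x xr)).
  exists s => //; have [E|E] := pselect (F' z = 0).
    left => x xs; split; last by have [H _] := Hs x xs; exact: H.
    rewrite -Fz; apply: CD0_ball_const xs => y ys.
    by have := CF y; have [H _] := Hs y ys; rewrite H.
  by right => x xs [_ Fx]; apply: E; have [_ H] := Hs x xs; exact: H.
have FE : F =1 (fun=> F z1).
  by apply: (cofinite_eq Vc Fc) => [z|z /Tall[-> _]]; [exact: cont_cst|].
by move: v0; rewrite -(FE z0) Fz0 eqxx.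
Qed.

(** If [M] is the maximum of [cabs F] on the segment from [z] to [x], the mean value inequality
    gives [M <= K * M * cabs (y c - z)]; on a segment shorter than [1 / (2 K)] this forces
    [M = 0]. *)
Lemma linear_ode_local_zero F F' k z (r : R) :
  (forall x, CD F x (F' x)) -> {for z, continuous k} -> F z = 0 -> 0 < r ->
  (forall x, cabs (x - z) < r -> F' x = F x * k x) ->
  exists2 s : R, 0 < s & forall x, cabs (x - z) < s -> F x = 0.
Proof.
move=> CF kz Fz r0 ode; pose K := cabs (k z) + 1.
have K0 : 0 < K by rewrite ltr_wpDl// cabs_ge0.
have /continuous_CCP/(_ _ ltr01)/near_CCP[q q0 Hq] := kz.
have K20 : 0 < (2 * K)^-1 by rewrite invr_gt0 mulr_gt0.
exists (Num.min (Num.min q r) (2 * K)^-1); first by rewrite !lt_min q0 r0.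
move=> x; rewrite !lt_min => /andP[/andP[xq xr] xK].
pose y t := z + ofR t * (x - z).
have kK t : 0 <= t <= 1 -> cabs (k (y t)) <= K.
  move=> t01; rewrite -[k (y t)](subrK (k z)); apply: le_trans (cabsD _ _) _.
  by rewrite /K addrC lerD2l; apply/ltW/Hq; exact: ball_segment.
have cF : {within `[0 : R, 1], continuous (fun t => cabs (F (y t)))}.
  apply: continuous_subspaceT => t.
  have H : {for t, continuous (fun s => F (z + ofR s * (x - z)))}.
    by apply: continuous_line; apply: CD_continuous (CF _).
  exact: (continuous_comp H (@continuous_cabs R _)).
have [c /[!in_itv]/= c01 cmax] := EVT_max ler01 cF.
pose M := cabs (F (y c)).
have yc : y c - z = ofR c * (x - z) by rewrite /y addrC addKr.
have Mle : M <= K * M * cabs (y c - z).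
  rewrite {1}/M -[F (y c)]subr0 -Fz.
  apply: (@mean_value R F (fun s => F' (y (s * c)))).
    move=> s s01; have -> : z + ofR s * (y c - z) = y (s * c).
      by rewrite yc /y rmorphM; ring.
    exact: CF.
  move=> s /andP[s0 s1]; have /andP[c0 c1] := c01.
  have sc : 0 <= s * c <= 1 by rewrite mulr_ge0//= mulr_ile1.
  rewrite ode; last exact: ball_segment.
  rewrite cabsM mulrC ler_pM ?cabs_ge0// ?kK// /M cmax// in_itv//=.
have M0 : M = 0.
  have M_ge0 : 0 <= M by exact: cabs_ge0.
  apply/eqP; rewrite eq_le M_ge0 andbT; apply: contraT; rewrite -ltNge => Mp.
  have : cabs (y c - z) < (2 * K)^-1 by apply: ball_segment.
  rewrite -[(2 * K)^-1]mul1r ltr_pdivlMr ?mulr_gt0// => H.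
  have : M * (cabs (y c - z) * (2 * K)) < M * 1 by rewrite ltr_pM2l.
  by move: Mle; rewrite (_ : K * M * cabs (y c - z) = M * (cabs (y c - z) * K)); [lra|ring].
have := cmax 1; rewrite in_itv /= lexx ler01 -/M M0 => /(_ isT).
have -> : y 1 = x by rewrite /y rmorph1 mul1r addrC subrK.
by move=> H; apply/eqP; rewrite -cabs_eq0 eq_le H cabs_ge0.
Qed.

Lemma linear_ode_neq0 V F F' k :
  cofinite_locally V -> (forall z, V z -> \forall x \near z, V x) ->
  (forall x, CD F x (F' x)) -> (forall z, V z -> {for z, continuous k}) ->
  (forall z, V z -> F' z = F z * k z) ->
  (exists z1, F z1 != 0) -> forall z, V z -> F z != 0.
Proof.
move=> Vc Vo CF kc ode [z1 Fz1] z Vz; apply/eqP => Fz.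
have Fc x : {for x, continuous F} by exact: CD_continuous (CF x).
have Tall x : V x -> F x = 0.
  move=> Vx; apply: (@locally_constant_global R V (fun x => F x = 0) Vc _ z x Vz Vx Fz) => y Vy.
  move: y Vy => {Vx}{}x Vx.
  have [Fx|Fx] := eqVneq (F x) 0; last first.
    have /near_CCP[r r0 Hr] := cont_near_neq0 (Fc x) Fx.
    by exists r => //; right => y /Hr /eqP.
  have /near_CCP[r r0 Hr] := Vo x Vx.
  have [s s0 Hs] := linear_ode_local_zero CF (kc x Vx) Fx r0 (fun y yr => ode y (Hr y yr)).
  by exists s => //; left.
have FE : F =1 (fun=> 0) by apply: (cofinite_eq Vc Fc) => [y|y /Tall]; [exact: cont_cst|].
by move: Fz1; rewrite FE eqxx.
Qed.

End LinearODE.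

(** * Residues of logarithmic derivatives *)

Section Residue.
Variable R : realType.
Implicit Types (F G k psi : CC R -> CC R) (z u beta : CC R).

Lemma is_derive_mul_sqr_sum (X Y : R -> R) (s dX dY : R) :
  is_derive s 1 X dX -> is_derive s 1 Y dY ->
  is_derive s 1 (fun t => t * (X t ^+ 2 + Y t ^+ 2))
    (X s ^+ 2 + Y s ^+ 2 + s * (2 * (X s * dX + Y s * dY))).
Proof.
move=> DX DY.
have D := is_deriveM (is_derive_id s 1) (is_deriveD (is_deriveM DX DX) (is_deriveM DY DY)).
have E : (fun t => t * (X t ^+ 2 + Y t ^+ 2)) = @id R * (X * X + Y * Y).
  by apply/funext => t; rewrite !expr2.
rewrite E; apply: is_derive_eq; rewrite /GRing.scale /=.
by rewrite -[(X * X + Y * Y) s]/(X s * X s + Y s * Y s); ring.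
Qed.

(* Along such a ray [s |F|^2] is nonincreasing in [s], so [F] would be
   unbounded near [z]. *)
Lemma no_blowup_on_ray F F' z u (r : R) : (forall x, CD F x (F' x)) -> 0 < r ->
  (forall s : R, 0 < s < r -> F (z + ofR s * u) != 0) ->
  (forall s : R, 0 < s < r ->
    1 + 2 * s * complex.Re (u * F' (z + ofR s * u) / F (z + ofR s * u)) <= 0) -> False.
Proof.
move=> CF r0 F0 le0; pose y s := z + ofR s * u.
(* [CD_line] differentiates real parts only, so the imaginary part of [F] enters as the real part of
   [- i F]. *)
pose X s := complex.Re (1 * F (y s)); pose Y s := complex.Re ((Complex 0 (- 1) : CC R) * F (y s)).
have XY s : X s ^+ 2 + Y s ^+ 2 = cabs (F (y s)) ^+ 2.
  by rewrite cabs_sqr /X /Y !cReM /=; ring.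
pose phi s := s * (X s ^+ 2 + Y s ^+ 2).
pose dphi s := X s ^+ 2 + Y s ^+ 2 + s * (2 * (X s * complex.Re (1 * F' (y s) * u) +
    Y s * complex.Re ((Complex 0 (- 1) : CC R) * F' (y s) * u))).
have D (s : R) : is_derive s 1 phi (dphi s).
  by apply: is_derive_mul_sqr_sum; exact: CD_line.
have dphi_le0 s : 0 < s < r -> dphi s <= 0.
  move=> sr; have Fs := F0 s sr; have := le0 s sr; rewrite -/(y s) in Fs *.
  set m := u * F' (y s) / F (y s) => ms.
  have uF : F' (y s) * u = F (y s) * m by rewrite /m; field.
  clearbody m.
  have -> : dphi s = cabs (F (y s)) ^+ 2 * (1 + 2 * s * complex.Re m).
    rewrite /dphi XY cabs_sqr /X /Y -!mulrA uF !cReM !cImM /=; ring.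
  by rewrite mulr_ge0_le0// sqr_ge0.
have dec a b : 0 < a -> a <= b -> b < r -> phi b <= phi a.
  move=> a0 ab br; have [c /andP[ac cb] E] := is_derive_MVT ab (fun t _ => D t).
  rewrite -subr_le0 E mulr_le0_ge0 ?subr_ge0//; apply: dphi_le0.
  by rewrite (lt_le_trans a0 ac) (le_lt_trans cb br).
pose b := r / 2.
have b0 : 0 < b by rewrite divr_gt0.
have br : b < r by rewrite /b; lra.
have phib : 0 < phi b.
  by rewrite /phi XY mulr_gt0// exprn_gt0// cabs_gt0 F0// b0.
have Fz : {for z, continuous F} by exact: CD_continuous (CF z).
have /continuous_CCP/(_ _ ltr01)/near_CCP[q q0 Hq] := Fz.
pose M := (cabs (F z) + 1) ^+ 2.
have M0 : 0 < M by rewrite exprn_gt0// ltr_wpDl// cabs_ge0.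
have u1 : 0 < cabs u + 1 by rewrite ltr_wpDl// cabs_ge0.
(* Near [z] one has [cabs F ^+ 2 <= M], so this [a] yields [phi a <= phi b / 2], against
   [phi b <= phi a] and [phi b > 0]. *)
pose a := Num.min (Num.min b (q / (cabs u + 1) / 2)) (phi b / M / 2).
have a0 : 0 < a by rewrite !lt_min b0 !divr_gt0.
have ab : a <= b by rewrite !ge_min lexx.
have aq : a <= q / (cabs u + 1) / 2 by rewrite !ge_min lexx !orbT.
have aM : a <= phi b / M / 2 by rewrite !ge_min lexx !orbT.
have := dec a b a0 ab br.
have : cabs (F (y a)) ^+ 2 <= M.
  rewrite lerXn2r ?nnegrE ?cabs_ge0 ?addr_ge0 ?cabs_ge0//.
  rewrite -[F (y a)](subrK (F z)); apply: le_trans (cabsD _ _) _.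
  rewrite addrC lerD2l; apply/ltW/Hq; rewrite /y addrC addKr cabsM cabs_ofR gtr0_norm//.
  have qu : 0 < q / (cabs u + 1) by rewrite divr_gt0.
  have : a < q / (cabs u + 1) by lra.
  rewrite ltr_pdivlMr//; apply: le_lt_trans; rewrite ler_pM2l//.
  by rewrite lerDl.
move=> FM; rewrite {2}/phi XY => H.
have : a * cabs (F (y a)) ^+ 2 <= phi b / M / 2 * M by rewrite ler_pM ?sqr_ge0// ltW.
have -> : phi b / M / 2 * M = phi b / 2 by field; rewrite gt_eqF.
by lra.
Qed.

Lemma cabs_two_pi_i : cabs (two_pi_i R) = 2 * pi.
Proof.
have p0 : 0 < 2 * pi :> R by rewrite mulr_gt0// pi_gt0.
apply/eqP; rewrite -(@eqrXn2 _ 2) ?cabs_ge0 ?(ltW p0)// cabs_sqr /=.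
by rewrite expr0n /= add0r.
Qed.

Lemma cabs_wexp_real (t : R) : cabs (wexp (ofR t)) = 1.
Proof. by rewrite /wexp cabs_cexp cReM /= mul0r mulr0 subrr expR0. Qed.

(* [F (z + rho e^(2 pi i t))] is multiplied by approximately [e^(2 pi i beta)]
   when [t] runs over [0, 1]. *)
Lemma residue_monodromy F F' psi z (r : R) : (forall x, CD F x (F' x)) -> 0 < r ->
  {for z, continuous psi} ->
  (forall x, x != z -> cabs (x - z) < r -> F x != 0) ->
  (forall x, x != z -> cabs (x - z) < r -> F' x * (x - z) = F x * psi x) ->
  cexp (two_pi_i R * - psi z) = 1.
Proof.
move=> CF r0 psiz F0 ode; pose beta := psi z.
have pi2 : 0 < 2 * pi :> R by rewrite mulr_gt0// pi_gt0.
suff small e : 0 < e -> 2 * pi * e <= 2^-1 ->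
    cabs (cexp (two_pi_i R * - beta) - 1) <= 2 * (2 * pi * e).
  apply/eqP; rewrite -subr_eq0 -cabs_eq0 eq_le cabs_ge0 andbT.
  apply: contraT; rewrite -ltNge; set c := cabs _ => c0.
  pose m := Num.min (2^-1) (c / 4); have m0 : 0 < m by rewrite lt_min invr_gt0 ltr0n /= divr_gt0.
  have m1 : m <= 2^-1 by rewrite ge_min lexx.
  have m2 : m <= c / 4 by rewrite ge_min lexx orbT.
  have := small (m / (2 * pi)); rewrite divr_gt0// => /(_ isT).
  rewrite mulrC divfK ?gt_eqF// => /(_ m1); rewrite -/c; lra.
move=> e0 e2.
have /continuous_CCP/(_ _ e0)/near_CCP[q q0 Hq] := psiz.
pose rho := Num.min q r / 2.
have rho0 : 0 < rho by rewrite divr_gt0// lt_min q0.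
have : rho < Num.min q r.
  by rewrite /rho ltr_pdivrMr// ltr_pMr ?ltr1n// lt_min q0.
rewrite lt_min => /andP[rhoq rhor].
pose x s := z + ofR rho * wexp s.
have xz s : x s - z = ofR rho * wexp s by rewrite /x addrC addKr.
have xr t : cabs (x (ofR t) - z) = rho.
  by rewrite xz cabsM cabs_ofR cabs_wexp_real mulr1 gtr0_norm.
have xnz t : x (ofR t) != z by rewrite -subr_eq0 -cabs_eq0 xr gt_eqF.
(* [delta] would be constant if [psi] were equal to [beta] on the circle; in general its logarithmic
   derivative is [2 pi i (psi - beta)], which is small. *)
pose delta s := F (x s) * cexp (two_pi_i R * - beta * s).
have Cdelta t : CD delta (ofR t) (two_pi_i R * (psi (x (ofR t)) - beta) * delta (ofR t)).
  have Cx : CD x (ofR t) (ofR rho * (two_pi_i R * wexp (ofR t))).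
    have := CDD (CD_cst z (ofR t)) (CDZ (ofR rho) (CD_wexp (ofR t))).
    by rewrite add0r.
  have := CDM (CD_comp Cx (CF (x (ofR t))))
    (CD_comp (CDZ (two_pi_i R * - beta) (CD_id (ofR t))) (CD_cexp _)).
  set D := (_ + _); set D' := (_ * delta _).
  suff -> : D = D' by [].
  rewrite /D /D' /delta mulr1.
  have := ode (x (ofR t)) (xnz t); rewrite xr rhor xz => /(_ isT) E.
  have -> : F' (x (ofR t)) * (ofR rho * (two_pi_i R * wexp (ofR t))) =
    two_pi_i R * (F (x (ofR t)) * psi (x (ofR t))) by rewrite -E; ring.
  by ring.
have small t : cabs (psi (x (ofR t)) - beta) <= e by apply/ltW/Hq; rewrite xr.
have cd : {within `[0 : R, 1], continuous (fun t => cabs (delta (ofR t)))}.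
  apply: continuous_subspaceT => t.
  have H : {for t, continuous (fun s => delta (ofR s))}.
    apply: (continuous_comp (@continuous_ofR R t)).
    exact: CD_continuous (Cdelta t).
  exact: (continuous_comp H (@continuous_cabs R _)).
have [c /[!in_itv]/= c01 cmax] := EVT_max ler01 cd.
pose M := cabs (delta (ofR c)).
have d0 : delta 0 = F (x 0) by rewrite /delta mulr0 cexp0 mulr1.
have Md t : 0 <= t <= 1 -> cabs (delta (ofR t) - delta 0) <= 2 * pi * e * M.
  move=> /andP[t0 t1].
  have := @mean_value R delta (fun s => two_pi_i R * (psi (x (ofR (s * t))) - beta) *
    delta (ofR (s * t))) 0 (ofR t) (2 * pi * e * M).
  move=> H; apply: le_trans (H _ _) _.
  - by move=> s _; rewrite subr0 add0r -rmorphM; exact: Cdelta.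
  - move=> s /andP[s0 s1]; rewrite cabsM (cabsM (two_pi_i R)) cabs_two_pi_i.
    apply: ler_pM; rewrite ?mulr_ge0 ?cabs_ge0 ?(ltW pi2) ?pi_ge0//.
      by rewrite ler_pM2l//; exact: small.
    by rewrite /M cmax// in_itv /= mulr_ge0// mulr_ile1.
  have M_ge0 : 0 <= M by exact: cabs_ge0.
  by rewrite subr0 cabs_ofR ger0_norm// ler_piMr// !mulr_ge0// ?pi_ge0// ltW.
(* Absorption: the variation of [delta] is at most [2 * pi * e * M <= M / 2], so its maximum [M] is
   controlled by its initial value. *)
have M2 : M <= 2 * cabs (delta 0).
  have := Md c c01; have := cabs_dist (delta (ofR c)) (delta 0); rewrite -/M.
  have : 2 * pi * e * M <= 2^-1 * M by rewrite ler_wpM2r// cabs_ge0.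
  lra.
have := Md 1; rewrite lexx ler01 => /(_ isT).
have x1 : x 1 = x 0.
  rewrite /x; congr (_ + _ * _); rewrite -[in LHS](add0r 1).
  by rewrite -(wexp_period 0 1).
have -> : delta (ofR 1) - delta 0 = F (x 0) * (cexp (two_pi_i R * - beta) - 1).
  by rewrite d0 rmorph1 /delta x1 mulr1; ring.
rewrite cabsM.
have F00 : 0 < cabs (F (x 0)).
  have := xnz 0; have := xr 0; rewrite rmorph0 cabs_gt0 => x0 xn0.
  by apply: F0 => //; rewrite x0.
move=> H; rewrite -(ler_pM2l F00); apply: le_trans H _.
apply: le_trans (ler_wpM2l _ M2) _; first by rewrite !mulr_ge0// ?pi_ge0// ltW.
by rewrite d0 le_eqVlt; apply/orP; left; apply/eqP; ring.
Qed.

Lemma root_of_unit_modulus (c : CC R) n : cabs c = 1 -> exists2 u, u ^+ n.+1 = c & cabs u = 1.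
Proof.
move=> c1; exists (n.+1.-root c); first by rewrite rootCK.
apply/eqP; rewrite -(@eqrXn2 _ n.+1) ?cabs_ge0// -cabsX rootCK//.
by rewrite c1 expr1n.
Qed.

(** At a pole of order at least 2 some direction [u] makes [psi z * u ^- j] a negative real number,
    and [F] would blow up along it. At a simple pole single-valuedness makes [psi z] an integer, and
    a negative one would again cause a blow-up. *)
Lemma residue_pos_int F F' psi z (r : R) j : (forall x, CD F x (F' x)) -> 0 < r ->
  {for z, continuous psi} -> psi z != 0 ->
  (forall x, x != z -> cabs (x - z) < r -> F x != 0) ->
  (forall x, x != z -> cabs (x - z) < r -> F' x * (x - z) ^+ j.+1 = F x * psi x) ->
  j = 0%N /\ exists n : nat, psi z = n.+1%:R.
Proof.
move=> CF r0 psic psi0 F0 ode.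
have b0 : 0 < cabs (psi z) by rewrite cabs_gt0.
have ray u s : cabs u = 1 -> 0 < s < r ->
    let x := z + ofR s * u in [/\ x != z, cabs (x - z) = s, F x != 0 &
      u * F' x / F x = psi x * (ofR s ^- j.+1 * u ^- j)].
  move=> u1 /andP[s0 sr] x.
  have xz : x - z = ofR s * u by rewrite /x addrC addKr.
  have xs : cabs (x - z) = s by rewrite xz cabsM cabs_ofR u1 mulr1 gtr0_norm.
  have xnz : x != z by rewrite -subr_eq0 -cabs_eq0 xs gt_eqF.
  have Fx : F x != 0 by apply: F0 => //; rewrite xs.
  split => //; have := ode x xnz; rewrite xs xz => /(_ sr).
  have sC : ofR s != 0 by rewrite -(rmorph0 (@ofR R)) (inj_eq (@ofRI R)) gt_eqF.
  have uC : u != 0 by rewrite -cabs_eq0 u1 oner_eq0.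
  rewrite exprMn (exprS u) => E.
  have sj : ofR s ^+ j.+1 != 0 by rewrite expf_neq0.
  have uj : u ^+ j != 0 by rewrite expf_neq0.
  apply: (mulIf Fx); rewrite divfK//; apply: (mulIf sj); apply: (mulIf uj).
  have -> : u * F' x * ofR s ^+ j.+1 * u ^+ j = F x * psi x by rewrite -E; ring.
  set S := ofR s ^+ j.+1 in sj *; set W := u ^+ j in uj *.
  by field; rewrite sj uj.
have e0 : 0 < cabs (psi z) / 2 by rewrite divr_gt0.
have /continuous_CCP/(_ _ e0)/near_CCP[q q0 Hq] := psic.
case: j ode ray => [|j] ode ray; last first.
  exfalso; have [u uE u1] : exists2 u, u ^+ j.+1 = - (psi z / ofR (cabs (psi z))) & cabs u = 1.
    apply: root_of_unit_modulus; rewrite cabsN cabsM cabsV cabs_ofR.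
    by rewrite ger0_norm ?cabs_ge0// divff// gt_eqF.
  (* [s < q] keeps [psi] within half of [cabs (psi z)] from its limit, [s < 1] gives
     [s^-1 <= s ^- j.+1], and [s < cabs (psi z)] makes the negative term outweigh the summand 1. *)
  pose r1 := Num.min (Num.min r q) (Num.min 1 (cabs (psi z))).
  have r10 : 0 < r1 by rewrite !lt_min r0 q0 b0 ltr01.
  apply: (no_blowup_on_ray CF r10 (u := u) (z := z)) => s /andP[s0].
    by rewrite !lt_min => /andP[/andP[sr _] _]; have [] := ray u s u1 (introT andP (conj s0 sr)).
  rewrite !lt_min => /andP[/andP[sr sq] /andP[s1 sb]].
  have sr' : 0 < s < r by rewrite s0.
  have [xz xs Fx ->] := ray u s u1 sr'; set x := z + _ in xz xs Fx *.
  have cpsi : ofR (cabs (psi z)) != 0.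
    by rewrite -(rmorph0 (@ofR R)) (inj_eq (@ofRI R)) gt_eqF.
  have uV : u ^- j.+1 = - (ofR (cabs (psi z)) / psi z) by rewrite uE invrN invf_div.
  have -> : psi x * (ofR s ^- j.+2 * u ^- j.+1) =
      ofR (s ^- j.+2) * (- ofR (cabs (psi z)) + (psi x - psi z) * u ^- j.+1).
    rewrite fmorphV rmorphXn /= uV; set S := (_ ^- _).
    by field.
  have dle : cabs ((psi x - psi z) * u ^- j.+1) <= cabs (psi z) / 2.
    rewrite cabsM cabsV cabsX u1 expr1n invr1 mulr1; apply/ltW/Hq.
    by rewrite xs.
  rewrite cReM /= mul0r subr0 cReD /=.
  have := le_trans (Re_le_cabs _) dle; rewrite ler_norml => /andP[_ dRe].
  set A := complex.Re _ in dRe *; set b := cabs (psi z) in dRe b0 sb *.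
  have Ab : - b + A <= - (b / 2) by lra.
  have sj : s^-1 <= s ^- j.+1.
    rewrite -exprVn -[X in X <= _]expr1; apply: ler_weXn2l => //.
    by rewrite invr_ge1 ?unitfE ?gt_eqF// ltW.
  have bs : 1 <= b * s^-1 by rewrite ler_pdivlMr// mul1r ltW.
  have -> : 2 * s * (s ^- j.+2 * (- b + A)) = s ^- j.+1 * (2 * (- b + A)).
    by rewrite exprS; field; rewrite expf_neq0 ?gt_eqF.
  have h1 : s ^- j.+1 * (2 * (- b + A)) <= s ^- j.+1 * (- b).
    by rewrite ler_pM2l ?invr_gt0 ?exprn_gt0//; lra.
  have h2 : b * s^-1 <= b * s ^- j.+1 by rewrite ler_pM2l.
  by move: h1; rewrite mulrN [_ * b]mulrC; lra.
split=> //; have : cexp (two_pi_i R * - psi z) = 1.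
  apply: (residue_monodromy CF r0 psic F0) => x xz xr.
  by rewrite -(ode x xz xr) expr1.
move=> /cexp_eq1[n nE].
have [m mE] : exists m : int, psi z = m%:~R by exists (- n); rewrite mulrNz -nE opprK.
case: m mE => [[|m]|m] mE; first by move: psi0; rewrite mE eqxx.
  by exists m.
(* For [psi z <= -1] a distance of one half suffices: [1 + 2 * Re psi <= 1 + 2 * (-1 + 1 / 2) =
   0]. *)
exfalso; have e2 : 0 < 2^-1 :> R by rewrite invr_gt0.
have /continuous_CCP/(_ _ e2)/near_CCP[p p0 Hp] := psic.
pose r1 := Num.min r p; have r10 : 0 < r1 by rewrite lt_min r0.
apply: (no_blowup_on_ray CF r10 (u := 1) (z := z)) => s /andP[s0].
  by rewrite lt_min => /andP[sr _]; have [] := ray 1 s (cabs1 R) (introT andP (conj s0 sr)).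
rewrite lt_min => /andP[sr sp].
have sr' : 0 < s < r by rewrite s0.
have [xz xs Fx ->] := ray 1 s (cabs1 R) sr'; set x := z + _ in xz xs Fx *.
rewrite expr1 expr0 invr1 mulr1 -fmorphV cReM /= mulr0 subr0.
have -> : 2 * s * (complex.Re (psi x) * s^-1) = 2 * complex.Re (psi x).
  by field; rewrite gt_eqF.
have Rez : complex.Re (psi z) <= -1.
  have -> : psi z = ofR (Negz m)%:~R by rewrite mE rmorph_int.
  by rewrite /= NegzE mulrNz lerN2 ler1n.
have := Re_le_cabs (psi x - psi z); rewrite cReB ler_norml => /andP[_ h].
have : cabs (psi x - psi z) < 2^-1 by apply: Hp; rewrite xs.
lra.
Qed.

End Residue.

(** * The Newton equation *)

Section NewtonODE.
Variables (R : realType) (F : CC R -> CC R) (l : int) (p q : {poly CC R}).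
Hypothesis entF : entire F.
Hypothesis zeroF : exists z0 : CC R, F z0 = 0.
Hypothesis nzF : exists z1 : CC R, F z1 != 0.
Hypothesis cop : coprimep p q.
Hypothesis q00 : q.[0] != 0.
Hypothesis qroot : exists w : CC R, root q w.
Hypothesis newtonE : forall z : CC R, cderiv F z != 0 -> q.[wexp z] != 0 ->
  newton F z = l%:~R * z + p.[wexp z] / q.[wexp z].

Let c : CC R := 1 - l%:~R.

(* [F / F' = (c z q - p) / q] at [w = e^(2 pi i z)]: [newton_den] is the
   denominator of [F' / F]. *)
Definition newton_den := epoly (c *: q, - p).
Definition newton_dom z := q.[wexp z] != 0 /\ newton_den z != 0.

Lemma newton_denE z : newton_den z = c * z * q.[wexp z] - p.[wexp z].
Proof. by rewrite /newton_den /epoly /= hornerZ hornerN; ring. Qed.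

Lemma CD_entire z : CD F z (cderiv F z).
Proof. exact: derivable_CD. Qed.

Lemma num_neq0 : p != 0.
Proof.
apply: contraTneq cop => ->; rewrite coprime0p; case: qroot => w qw.
by apply: contraTN qw => /eqp_root ->; rewrite root1.
Qed.

Lemma den_neq0 : q != 0.
Proof. by apply: contraNneq q00 => ->; rewrite horner0. Qed.

Lemma not_common_root w : q.[w] = 0 -> p.[w] != 0.
Proof. by move=> /eqP qw; apply: coprimep_root qw; rewrite coprimep_sym. Qed.

Lemma newton_den_ord z : exists j alpha, ord_at newton_den z j alpha.
Proof. by apply: ord_at_epoly; right; rewrite /= oppr_eq0 num_neq0. Qed.

Lemma horner_wexp_ord (P : {poly CC R}) z : P != 0 ->
  exists j alpha, ord_at (fun x => P.[wexp x]) z j alpha.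
Proof.
move=> P0; have [|j [al H]] := @ord_at_epoly R (0, P) z; first by right.
exists j, al; have -> // : (fun x => P.[wexp x]) = epoly (0, P).
by apply/funext => x; rewrite /epoly /= horner0 mulr0 add0r.
Qed.

Lemma newton_dom_cofinite : cofinite_locally newton_dom.
Proof.
move=> z; have [j [al /ord_at_isolated[r r0 Hr]]] := newton_den_ord z.
have [i [be /ord_at_isolated[s s0 Hs]]] := horner_wexp_ord z den_neq0.
exists (Num.min r s); first by rewrite lt_min r0.
move=> x xz; rewrite lt_min => /andP[xr xs].
by split; [exact: Hs|exact: Hr].
Qed.

Lemma cont_horner_wexp (P : {poly CC R}) z : {for z, continuous (fun x => P.[wexp x])}.
Proof. exact: CD_continuous (CD_horner_wexp P z). Qed.

Lemma cont_newton_den z : {for z, continuous newton_den}.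
Proof. exact: CD_continuous (CD_epoly _ z). Qed.

Lemma newton_dom_open z : newton_dom z -> \forall x \near z, newton_dom x.
Proof.
move=> [q1 h1]; apply/near_CCP.
apply: (@near_CC_min R z (fun x => q.[wexp x] != 0) (fun x => newton_den x != 0)).
  exact: (@cont_near_neq0 _ (fun x => q.[wexp x]) z (@cont_horner_wexp q z) q1).
exact: (@cont_near_neq0 _ newton_den z (@cont_newton_den z) h1).
Qed.

Let k z := q.[wexp z] / newton_den z.

Lemma cont_logder z : newton_dom z -> {for z, continuous k}.
Proof.
move=> [q1 h1]; apply: contM; first exact: cont_horner_wexp.
by apply: contV h1 _; exact: cont_newton_den.
Qed.

Lemma newton_ode z : newton_dom z -> cderiv F z = F z * (q.[wexp z] / newton_den z).
Proof.
apply: (derivative_choice newton_dom_cofinite newton_dom_open CD_entire cont_logder) => //.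
  by move=> {}z [q1 h1]; rewrite mulf_neq0// invr_eq0.
move=> {}z [q1 h1]; have [->|d0] := eqVneq (cderiv F z) 0; [by left|right].
have := newtonE d0 q1; rewrite /newton => E.
have FE : F z / cderiv F z = newton_den z / q.[wexp z].
  have -> : F z / cderiv F z = z - (z - F z / cderiv F z) by ring.
  by rewrite E newton_denE /c; field.
rewrite /k -[q.[_] / _]invf_div -FE; field.
have : F z / cderiv F z != 0 by rewrite FE mulf_neq0// invr_eq0.
by rewrite mulf_eq0 negb_or => /andP[F1 _]; rewrite F1 d0.
Qed.

Lemma newton_dom_neq0 z : newton_dom z -> F z != 0.
Proof.
exact: (linear_ode_neq0 newton_dom_cofinite newton_dom_open CD_entire cont_logder newton_ode).
Qed.

Definition newton_den' := epoly (eder (c *: q, - p)).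

(** Writing [newton_den] as a power of [x - z] times [g], the function [psi = q(w) / g] is the one
    to which [residue_pos_int] applies. It shows that the zero is simple, so [g z] is the derivative
    and [psi z] the residue of [F' / F]. Coprimality gives [q(w) <> 0] there. *)
Lemma newton_den_residue z : newton_den z = 0 ->
  exists n : nat, q.[wexp z] = n.+1%:R * newton_den' z.
Proof.
move=> hz.
have qz : q.[wexp z] != 0.
  apply/eqP => q0; have := not_common_root q0; have := hz.
  rewrite newton_denE q0 mulr0 sub0r => /eqP; rewrite oppr_eq0 => ->//.
have [j [al H]] := newton_den_ord z.
case: j H => [|j] H; have [a0 [g gz [ga hE]]] := H.
  by move: a0; rewrite -ga -(mul1r (g z)) -(hE z) hz eqxx.
have gz0 : g z != 0 by rewrite ga.
pose psi x := q.[wexp x] / g x.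
have psic : {for z, continuous psi}.
  by apply: contM; [exact: cont_horner_wexp|apply: contV gz0 gz].
have [r r0 Hr] := newton_dom_cofinite z.
have [|||j0 [n nE]] := @residue_pos_int R F (cderiv F) psi z r j CD_entire r0 psic.
- by rewrite mulf_neq0// invr_eq0.
- by move=> x xz xr; apply: newton_dom_neq0; exact: Hr.
- move=> x xz xr; have Vx := Hr x xz xr; rewrite (newton_ode Vx) hE /psi.
  have := Vx.2; rewrite hE mulf_eq0 negb_or => /andP[xj gx].
  by field; rewrite gx xj.
exists n; rewrite -nE /psi ga.
have -> : newton_den' z = al.
  by rewrite j0 in H; apply: ord_at_CD H _; exact: CD_epoly.
by rewrite divfK.
Qed.

End NewtonODE.

(** * The case l <> 1 *)

Section MinimumModulus.
Variable R : realType.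
Implicit Types (f : CC R -> CC R) (z u a : CC R).

(** The direction [u] makes the leading term [alpha * (s u)^(j + 1)] point opposite to [f z]. The
    bound [s < cabs (f z) / cabs alpha], with [s < 1], prevents overshooting 0, and the remainder is
    smaller than the gain. *)
Lemma no_local_min_modulus f z j alpha (r : R) : 
  ord_at (fun x => f x - f z) z j.+1 alpha -> f z != 0 -> 0 < r ->
  exists2 x, cabs (x - z) < r & cabs (f x) < cabs (f z).
Proof.
move=> [a0 [g gz [ga fE]]] f0 r0.
have a1 : 0 < cabs alpha by rewrite cabs_gt0.
have v0 : 0 < cabs (f z) by rewrite cabs_gt0.
have ofR0 (t : R) : 0 < t -> ofR t != 0.
  by move=> t0; rewrite -(rmorph0 (@ofR R)) (inj_eq (@ofRI R)) gt_eqF.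
have [u uE u1] : exists2 u, u ^+ j.+1 = - (f z / alpha) / ofR (cabs (f z / alpha)) & cabs u = 1.
  apply: root_of_unit_modulus; have : f z / alpha != 0 by rewrite mulf_neq0// invr_eq0.
  move: (f z / alpha) => t t0; rewrite cabsM cabsV cabs_ofR cabsN ger0_norm ?cabs_ge0//.
  by rewrite divff// cabs_eq0.
have /continuous_CCP/(_ _ a1)/near_CCP[q q0 Hq] := gz.
pose s := Num.min (Num.min r q) (Num.min 1 (cabs (f z) / cabs alpha)) / 2.
have m0 : 0 < Num.min (Num.min r q) (Num.min 1 (cabs (f z) / cabs alpha)).
  by rewrite !lt_min r0 q0 ltr01 divr_gt0.
have s0 : 0 < s by rewrite divr_gt0.
have : s < Num.min (Num.min r q) (Num.min 1 (cabs (f z) / cabs alpha)).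
  by rewrite /s ltr_pdivrMr// ltr_pMr ?ltr1n.
rewrite !lt_min => /andP[/andP[sr sq] /andP[s1 sv]].
clearbody s.
pose x := z + ofR s * u.
have xz : x - z = ofR s * u by rewrite /x addrC addKr.
have xs : cabs (x - z) = s by rewrite xz cabsM cabs_ofR u1 mulr1 gtr0_norm.
exists x; first by rewrite xs.
have fv : ofR (cabs (f z)) != 0 by exact: ofR0.
have av : ofR (cabs alpha) != 0 by exact: ofR0.
have -> : f x = f z * ofR (1 - s ^+ j.+1 * cabs alpha / cabs (f z)) +
    ofR (s ^+ j.+1) * u ^+ j.+1 * (g x - alpha).
  rewrite -[LHS](subrK (f z)) fE xz exprMn uE cabsM cabsV !(rmorphB, rmorph1, rmorphM, rmorphXn, fmorphV) /=.
  rewrite ?(rmorphXn, fmorphV) /=; field.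
  by rewrite a0 av fv.
have ss : s ^+ j.+1 <= s by rewrite exprS ler_piMr ?(ltW s0)// exprn_ile1 ?ltW.
have sj : 0 < s ^+ j.+1 by rewrite exprn_gt0.
apply: le_lt_trans (cabsD _ _) _; rewrite !cabsM !cabs_ofR cabsX u1 expr1n mulr1.
rewrite [`|s ^+ _|]gtr0_norm// ger0_norm; last first.
  rewrite subr_ge0 ler_pdivrMr// mul1r -ler_pdivlMr//.
  exact: le_trans ss (ltW sv).
have -> : cabs (f z) * (1 - s ^+ j.+1 * cabs alpha / cabs (f z)) =
  cabs (f z) - s ^+ j.+1 * cabs alpha by field; rewrite gt_eqF.
have : s ^+ j.+1 * cabs (g x - alpha) < s ^+ j.+1 * cabs alpha.
  by rewrite ltr_pM2l// -{1}ga Hq// xs.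
lra.
Qed.

Lemma continuous_cplane (a : CC R) :
  continuous (fun xy : R * R => a + (Complex xy.1 xy.2 : CC R)).
Proof.
move=> [x y] A /near_CCP[r r0 Hr]; have r20 : 0 < r / 2 by rewrite divr_gt0.
apply/nbhs_ballP; exists (r / 2) => //= -[x' y'] [/= xx yy]; apply: Hr.
have -> : a + (Complex x' y' : CC R) - (a + (Complex x y : CC R)) = Complex (x' - x) (y' - y).
  by apply: CC_eqP; rewrite ?cReB ?cImB ?cReD ?cImD /=; ring.
apply: le_lt_trans (cabs_le_ReIm _) _ => /=.
by move: xx yy; rewrite /ball /= !(distrC _ x') !(distrC _ y'); lra.
Qed.

(** The minimum is taken over the square of half-side [r], compact as a product of segments. The
    square contains the disc of radius [r] and lies in that of radius [2 * r]; the bound on the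
    annulus excludes the part outside the smaller disc, so the minimum is a local one. *)
Lemma min_modulus_zero f a (r : R) : 0 < r -> (forall z, {for z, continuous f}) ->
  (forall z, exists j alpha, ord_at (fun x => f x - f z) z j.+1 alpha) ->
  (forall z, r <= cabs (z - a) <= 2 * r -> cabs (f a) < cabs (f z)) ->
  exists2 z, cabs (z - a) <= 2 * r & f z = 0.
Proof.
move=> r0 fc ford bd.
pose K : set (R * R) := `[- r, r] `*` `[- r, r].
pose Z (xy : R * R) : CC R := a + (Complex xy.1 xy.2 : CC R).
have cK : compact K by apply: compact_setX; exact: segment_compact.
have K0 : K (0, 0) by split; rewrite /= in_itv /= oppr_le0 ltW.
have fK : {within K, continuous (fun xy => cabs (f (Z xy)))}.
  apply: continuous_subspaceT => xy.
  have H : {for xy, continuous (fun xy => f (Z xy))}.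
    by apply: (continuous_comp (@continuous_cplane a xy)); exact: fc.
  exact: (continuous_comp H (@continuous_cabs R _)).
have [m mK mmin] := compact_EVT_min (ex_intro _ _ K0) cK fK.
have ZE z : Z (complex.Re (z - a), complex.Im (z - a)) = z.
  by apply: CC_eqP; rewrite /Z ?cReD ?cImD /= ?cReB ?cImB; ring.
have KP z : cabs (z - a) < r -> K (complex.Re (z - a), complex.Im (z - a)).
  move=> zr; split; rewrite /= in_itv /= -ler_norml; apply/ltW; apply: le_lt_trans zr.
    exact: Re_le_cabs.
  exact: Im_le_cabs.
have Zm : cabs (Z m - a) <= 2 * r.
  move: mK; rewrite inE => -[/=]; rewrite !in_itv /= -!ler_norml => m1 m2.
  rewrite /Z addrC addKr; apply: le_trans (cabs_le_ReIm _) _ => /=; lra.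
exists (Z m) => //; apply/eqP; apply: contraT => f0.
have Zmr : cabs (Z m - a) < r.
  rewrite ltNge; apply/negP => rZ; have := bd (Z m); rewrite rZ Zm => /(_ isT).
  have := mmin (0, 0); rewrite inE => /(_ K0).
  have -> : Z (0, 0) = a by rewrite -[RHS]ZE subrr.
  by rewrite leNgt => /negP.
have [j [al H]] := ford (Z m).
have d0 : 0 < r - cabs (Z m - a) by rewrite subr_gt0.
have [x xr] := no_local_min_modulus H f0 d0.
have xa : cabs (x - a) < r.
  have -> : x - a = (x - Z m) + (Z m - a) by ring.
  by apply: le_lt_trans (cabsD _ _) _; rewrite -ltrBrDr.
have := mmin (complex.Re (x - a), complex.Im (x - a)); rewrite inE => /(_ (KP _ xa)).
by rewrite ZE leNgt => /negP.
Qed.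

End MinimumModulus.

(** * Zeros of the denominator near a pole, and the conclusion [l = 1] *)

Section LIsOne.
Variables (R : realType) (l : int) (p q : {poly CC R}).
Let c : CC R := 1 - l%:~R.

Lemma newton_den_sub_ord z : c != 0 -> q != 0 ->
  exists j alpha, ord_at (fun x => newton_den l p q x - newton_den l p q z) z j.+1 alpha.
Proof.
move=> c0 q0; set v := newton_den l p q z.
have [|j [al H]] := @ord_at_epoly R (c *: q, - p - v%:P) z.
  by left; rewrite /= scaler_eq0 negb_or c0.
have E : (fun x => newton_den l p q x - v) = epoly (c *: q, - p - v%:P).
  by apply/funext => x; rewrite /newton_den /epoly /= !(hornerD, hornerN, hornerC); ring.
case: j H => [|j] H; last by exists j, al; rewrite E.
case: H => a0 [g gz [ga gE]].
have : epoly (c *: q, - p - v%:P) z = 0 by rewrite -E subrr.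
by rewrite gE mul1r ga => /eqP; rewrite (negbTE a0).
Qed.

(* On a small circle around [a + n], [|c z q - p|] grows with [n], while at the
   centre it is [|p|]: the minimum modulus principle gives a zero. *)
Lemma newton_den_zero_near_pole (a : CC R) (e : R) : c != 0 -> q != 0 ->
  q.[wexp a] = 0 -> 0 < e ->
  exists2 z, newton_den l p q z = 0 & cabs (wexp z - wexp a) < e.
Proof.
move=> c0 q0 qa e0.
have wc : {for a, continuous (@wexp R)} by exact: CD_continuous (CD_wexp a).
have /continuous_CCP/(_ _ e0)/near_CCP[r1 r10 Hr1] := wc.
have pc : {for a, continuous (fun x => p.[wexp x])} by exact: cont_horner_wexp.
have /continuous_CCP/(_ _ ltr01)/near_CCP[r2 r20 Hr2] := pc.
have [j [al [a0 [g gc [ga gE]]]]] := horner_wexp_ord a q0.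
have al0 : 0 < cabs al / 2 by rewrite divr_gt0// cabs_gt0.
have /continuous_CCP/(_ _ al0)/near_CCP[r3 r30 Hr3] := gc.
pose r := Num.min (Num.min r1 r2) r3 / 4.
have m0 : 0 < Num.min (Num.min r1 r2) r3 by rewrite !lt_min r10 r20.
have r0 : 0 < r by rewrite divr_gt0.
have : 2 * r < Num.min (Num.min r1 r2) r3 by rewrite /r; move: (Num.min _ _) m0 => M; lra.
rewrite !lt_min => /andP[/andP[rr1 rr2] rr3]; clearbody r.
pose m := r ^+ j * (cabs al / 2).
have mm : 0 < m by rewrite mulr_gt0// exprn_gt0.
pose Mp := cabs p.[wexp a] + 1.
have qb y : r <= cabs (y - a) <= 2 * r -> m <= cabs q.[wexp y].
  move=> /andP[y1 y2]; rewrite gE cabsM cabsX; apply: ler_pM.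
  - by rewrite exprn_ge0// ltW.
  - exact: ltW.
  - by apply: lerXn2r; rewrite ?nnegrE ?cabs_ge0// ltW.
  have := Hr3 y (le_lt_trans y2 rr3); have := cabs_dist al (g y).
  by rewrite ga cabsC; lra.
have pb y : cabs (y - a) <= 2 * r -> cabs p.[wexp y] <= Mp.
  move=> y2; have := Hr2 y (le_lt_trans y2 rr2); have := cabs_dist p.[wexp y] p.[wexp a].
  by rewrite /Mp; lra.
have cm : 0 < cabs c * m by rewrite mulr_gt0// cabs_gt0.
(* On the annulus [cabs q >= m], [cabs p <= Mp] and [cabs z >= n - cabs a - 2 * r]. For [n > B] the
   term [c z q] therefore exceeds [Mp + cabs p.[wexp a] + 1], which leaves more than the value at
   the centre after subtracting [p]. *)
pose B := (Mp + cabs p.[wexp a] + 1) / (cabs c * m) + cabs a + 2 * r.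
have [n Bn] : exists n : nat, B < n%:R.
  by exists (Num.truncn B).+1; exact: truncnS_gt.
have nE : n%:R = ofR n%:R :> CC R by rewrite rmorph_nat.
have [|||z zr zE] := @min_modulus_zero R (newton_den l p q) (a + n%:R) r r0.
- by move=> z; exact: cont_newton_den.
- by move=> z; exact: newton_den_sub_ord.
- move=> z; pose y := z - n%:R.
  have -> : z - (a + n%:R) = y - a by rewrite /y; ring.
  have zy : z = y + n%:R by rewrite /y subrK.
  move=> yr; have /andP[y1 y2] := yr.
  rewrite !newton_denE -/c zy !wexp_period qa mulr0 sub0r cabsN.
  have h1 := qb y yr; have h2 := pb y y2.
  have h3 := cabs_dist (c * (y + n%:R) * q.[wexp y]) p.[wexp y].
  have h4 : n%:R - cabs a - 2 * r <= cabs (y + n%:R).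
    have := cabs_dist n%:R (- y); rewrite opprK cabsN [_ + y]addrC {1}nE cabs_ofR normr_nat.
    have := cabs_dist y a; lra.
  have h5 : (Mp + cabs p.[wexp a] + 1) / (cabs c * m) < n%:R - cabs a - 2 * r.
    by move: Bn; rewrite /B; lra.
  have h6 : Mp + cabs p.[wexp a] + 1 < cabs (y + n%:R) * (cabs c * m).
    by rewrite -ltr_pdivrMr//; exact: lt_le_trans h5 h4.
  have h7 : cabs (y + n%:R) * (cabs c * m) <= cabs (c * (y + n%:R) * q.[wexp y]).
    rewrite !cabsM mulrA [cabs (y + _) * _]mulrC ler_wpM2l ?mulr_ge0 ?cabs_ge0//.
  lra.
exists z => //; have zy : z = (z - n%:R) + n%:R by rewrite subrK.
rewrite zy wexp_period; apply: Hr1; apply: le_lt_trans rr1.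
by have -> : z - n%:R - a = z - (a + n%:R) by ring.
Qed.

(* Near a pole of [p / q], its derivative dominates: [q ^ 2 = o(p q' - p' q)]. *)
Lemma wronskian_dominates (w0 : CC R) (A : R) : q != 0 -> q.[w0] = 0 -> p.[w0] != 0 -> w0 != 0 ->
  exists2 e : R, 0 < e & forall w, q.[w] != 0 -> cabs (w - w0) < e ->
    A * cabs q.[w] ^+ 2 < cabs (two_pi_i R * w * (p.[w] * q^`().[w] - p^`().[w] * q.[w])).
Proof.
move=> q0 qw pw w00.
have [m [v]] := multiplicity_XsubC q w0; rewrite q0 /= => vw qE.
case: m qE => [|m] qE.
  by move: vw; rewrite /root -[v]mulr1 -[1]/(('X - w0%:P) ^+ 0) -qE qw eqxx.
(* With [q = v (w - w0)^(m + 1)], [g] is what remains of [p q' - p' q] after division by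
   [(w - w0)^m]; its value at [w0] is [(m + 1) p v], not 0. The same division turns [q^2] into [f2],
   which vanishes at [w0]. *)
pose g := p * (v^`() * ('X - w0%:P) + m.+1%:R *: v) - p^`() * v * ('X - w0%:P).
have WE w : p.[w] * q^`().[w] - p^`().[w] * q.[w] = (w - w0) ^+ m * g.[w].
  rewrite /g qE derivM deriv_exp derivXsubC mul1r /= -mulr_natl -polyC_natr mul_polyC.
  rewrite !(hornerD, hornerN, hornerM, hornerZ, horner_exp, hornerX, hornerC) !exprS; ring.
have gw : g.[w0] != 0.
  rewrite /g !(hornerE, subrr, mulr0, add0r, subr0) mulf_neq0// mulf_neq0// pnatr_eq0//.
pose f1 w := two_pi_i R * w * g.[w]; pose f2 w := (w - w0) ^+ m.+2 * v.[w] ^+ 2.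
have f1c : {for w0, continuous f1}.
  pose P1 := two_pi_i R *: 'X * g; have -> : f1 = horner P1.
    by apply/funext => w; rewrite /P1 /f1 hornerM hornerZ hornerX.
  exact: CD_continuous (CD_horner _ _).
have f2c : {for w0, continuous f2}.
  pose P2 := ('X - w0%:P) ^+ m.+2 * v ^+ 2; have -> : f2 = horner P2.
    by apply/funext => w; rewrite /P2 /f2 hornerM !horner_exp hornerXsubC.
  exact: CD_continuous (CD_horner _ _).
have K0 : 0 < cabs (f1 w0) / 2.
  by rewrite divr_gt0// cabs_gt0 !mulf_neq0// two_pi_i_neq0.
have A1 : 0 < `|A| + 1 by rewrite ltr_wpDl.
have e20 : 0 < cabs (f1 w0) / 2 / (`|A| + 1) by rewrite divr_gt0.
have /continuous_CCP/(_ _ K0)/near_CCP[r1 r10 Hr1] := f1c.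
have /continuous_CCP/(_ _ e20)/near_CCP[r2 r20 Hr2] := f2c.
exists (Num.min r1 r2); first by rewrite lt_min r10.
move=> w qw0; rewrite lt_min => /andP[/Hr1 H1 /Hr2].
have -> : f2 w0 = 0 by rewrite /f2 subrr expr0n /= mul0r.
rewrite subr0 ltr_pdivlMr// => H2.
have ww : w - w0 != 0 by rewrite subr_eq0; apply: contraNneq qw0 => ->; rewrite qw.
have wm : 0 < cabs (w - w0) ^+ m by rewrite exprn_gt0// cabs_gt0.
have -> : two_pi_i R * w * (p.[w] * q^`().[w] - p^`().[w] * q.[w]) = (w - w0) ^+ m * f1 w.
  by rewrite WE /f1; ring.
have -> : A * cabs q.[w] ^+ 2 = cabs (w - w0) ^+ m * (A * cabs (f2 w)).
  rewrite qE /f2 hornerM horner_exp hornerXsubC !cabsM !cabsX !exprS; ring.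
rewrite (cabsM ((w - w0) ^+ m)) cabsX ltr_pM2l//.
have : A * cabs (f2 w) <= `|A| * cabs (f2 w) by rewrite ler_wpM2r ?cabs_ge0// ler_norm.
have := cabs_dist (f1 w0) (f1 w); rewrite cabsC; have := cabs_ge0 (f2 w).
nra.
Qed.

End LIsOne.

Lemma newton_l_eq1 (R : realType) (F : CC R -> CC R) (l : int) (p q : {poly CC R}) :
  entire F -> (exists z0 : CC R, F z0 = 0) -> (exists z1 : CC R, F z1 != 0) ->
  coprimep p q -> q.[0] != 0 -> (exists w : CC R, root q w) ->
  (forall z : CC R, cderiv F z != 0 -> q.[wexp z] != 0 ->
    newton F z = l%:~R * z + p.[wexp z] / q.[wexp z]) -> l = 1.
Proof.
move=> entF zF nzF cop q00 qroot newtonE.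
apply/eqP; apply: contraT => l1; pose c : CC R := 1 - l%:~R.
have c0 : c != 0 by rewrite subr_eq0 eq_sym -[1]/(1%:~R) eqr_int.
have q0 := den_neq0 q00.
case: (qroot) => w0 /rootP qw0.
have w00 : w0 != 0 by apply: contraNneq q00 => w0E; move: qw0; rewrite w0E => ->.
have [a aE] := cexp_surj w00; rewrite -/(wexp a) in aE.
have pw0 := not_common_root cop qw0.
(* [1 + cabs c] bounds the modulus of [1 / (n + 1) - c] for every [n]. *)
have [e e0 He] := wronskian_dominates (1 + cabs c) q0 qw0 pw0 w00.
have qa : q.[wexp a] = 0 by rewrite aE.
have [z zE zw] := newton_den_zero_near_pole p c0 q0 qa e0.
have [n nE] := newton_den_residue entF zF nzF cop q00 qroot newtonE zE.
have qz : q.[wexp z] != 0.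
  apply/eqP => qz; have := not_common_root cop qz; move: zE.
  by rewrite newton_denE qz mulr0 sub0r => /eqP; rewrite oppr_eq0 => ->.
rewrite aE in zw; have := He _ qz zw; set w := wexp z in qz nE *.
have pE : p.[w] = c * z * q.[w].
  by apply/esym/eqP; rewrite -subr_eq0 -newton_denE zE.
have n0 : n.+1%:R != 0 :> CC R by rewrite pnatr_eq0.
(* At a zero of the denominator [p = c z q], so the Wronskian term is [(H' - c q) q]; the residue
   gives [H' = q / (n + 1)]. *)
have -> : two_pi_i R * w * (p.[w] * q^`().[w] - p^`().[w] * q.[w]) =
    q.[w] ^+ 2 * (n.+1%:R^-1 - c).
  have : newton_den' l p q z = c * q.[w] + two_pi_i R * w * (c * z * q^`().[w] - p^`().[w]).
    rewrite /newton_den' /epoly /eder /theta /= -/c.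
    by rewrite !(derivZ, derivN, hornerE) -/w /=; ring.
  move=> dE; rewrite pE; have E : newton_den' l p q z = q.[w] / n.+1%:R.
    by rewrite nE mulrC mulKf.
  have -> : two_pi_i R * w * (c * z * q.[w] * q^`().[w] - p^`().[w] * q.[w]) =
    (newton_den' l p q z - c * q.[w]) * q.[w] by rewrite dE; ring.
  by rewrite E; ring.
rewrite cabsM cabsX mulrC ltr_pM2l ?exprn_gt0 ?cabs_gt0//.
have : cabs (n.+1%:R^-1 - c) <= 1 + cabs c.
  apply: le_trans (cabsB _ _) _; rewrite lerD2r cabsV.
  have -> : n.+1%:R = ofR n.+1%:R :> CC R by rewrite rmorph_nat.
  by rewrite cabs_ofR normr_nat invf_le1 ?ltr0n// ler1n.
by move=> h1 h2; have := le_lt_trans h1 h2; rewrite ltxx.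
Qed.

(** * Partial fractions and the form of F *)

Section LogDerivativePoly.
Variable K : fieldType.
Implicit Types (rs : seq K) (P L : {poly K}).

(** [L / S] is [P' / P] in lowest terms. The third clause encodes that [w P' / P] tends to the
    degree of [P] at infinity, the fourth that the residues are the multiplicities. *)
Lemma logder_poly rs (n : K -> nat) : uniq rs ->
  let S := \prod_(x <- rs) ('X - x%:P) in
  let P := \prod_(x <- rs) ('X - x%:P) ^+ (n x).+1 in
  exists L, [/\ P^`() * S = P * L, (size L <= size rs)%N,
    ('X * L)`_(size rs) = ((size P).-1)%:R &
    forall x, x \in rs -> L.[x] = (n x).+1%:R * S^`().[x]].
Proof.
elim: rs => [|x rs IH] /=.
  by move=> _; rewrite !big_nil; exists 0; rewrite derivC !mul0r mulr0 size_poly0 mulr0 coef0 size_polyC oner_eq0.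
move=> /andP[xrs /IH[L1 [E1 sL1 cL1 V1]]]; rewrite !big_cons.
set S := \prod_(_ <- _) ('X - _) in E1 V1 *.
set P1 := \prod_(_ <- _) _ in E1 cL1 *.
have sS : size S = (size rs).+1 by rewrite size_prod_XsubC.
have mS : S \is monic by exact: monic_prod_XsubC.
have rS w : root S w = (w \in rs) by rewrite root_prod_XsubC.
have P10 : P1 != 0.
  by apply: monic_neq0; apply: monic_prod => y _; rewrite monic_exp// monicXsubC.
have mX : ('X - x%:P) ^+ (n x).+1 \is monic by rewrite monic_exp// monicXsubC.
exists ((n x).+1%:R *: S + ('X - x%:P) * L1); split.
- rewrite derivM deriv_exp derivXsubC mul1r /= -mulr_natl.
  have -> : (n x).+1%:R *: S = (n x).+1%:R * S by rewrite -mul_polyC polyC_natr.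
  set U := 'X - x%:P.
  transitivity ((n x).+1%:R * U ^+ n x * P1 * (U * S) + U ^+ (n x).+1 * U * (P1^`() * S)).
    by ring.
  by rewrite E1 exprS; ring.
- apply: leq_trans (size_polyD _ _) _; rewrite geq_max; apply/andP; split.
    by apply: leq_trans (size_scale_leq _ _) _; rewrite sS.
  apply: leq_trans (size_polyMleq _ _) _; rewrite size_XsubC /=.
  exact: sL1.
- rewrite coefXM /= coefD coefZ mulrBl coefB coefCM (nth_default _ sL1) mulr0 subr0 cL1.
  rewrite size_monicM// size_exp_XsubC addSn /=.
  have -> : S`_(size rs) = 1 by have /monicP := mS; rewrite lead_coefE sS.
  rewrite mulr1 -natrD; congr (_%:R).
  have : (0 < size P1)%N by rewrite size_poly_gt0.
  by case: (size P1) => // k _; rewrite addSnnS.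
- move=> y; rewrite inE derivM derivXsubC mul1r !hornerE => /predU1P[->|yrs].
    by rewrite subrr !mul0r !addr0.
  have /rootP -> : root S y by rewrite rS.
  by rewrite mulr0 !add0r V1// mulrCA.
Qed.

(** [M] only bounds the degree of [A]: the coefficient may be 0, a case that leading coefficients do
    not see. *)
Lemma coefM_monic (A S : {poly K}) M s : S \is monic -> size S = s.+1 ->
  (size A <= M.+1)%N -> (A * S)`_(M + s) = A`_M.
Proof.
move=> mS sS sA; have MN : (M < (M + s).+1)%N by rewrite ltnS leq_addr.
rewrite coefM (bigD1 (Ordinal MN)) //= addKn.
have -> : S`_s = 1 by have /monicP := mS; rewrite lead_coefE sS.
rewrite mulr1 big1 ?addr0// => -[k kN] /=; rewrite -val_eqE /= neq_ltn => /orP[kM|Mk].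
  by rewrite [S`__]nth_default ?mulr0// sS ltn_subRL ltn_add2r.
by rewrite nth_default ?mul0r//; exact: leq_trans sA Mk.
Qed.

Lemma root_prod_XsubC_exp rs (n : K -> nat) w :
  root (\prod_(x <- rs) ('X - x%:P) ^+ (n x).+1) w = (w \in rs).
Proof.
elim: rs => [|x rs IH]; first by rewrite big_nil; apply/negbTE; rewrite root1.
by rewrite big_cons rootM IH root_exp_XsubC inE.
Qed.

End LogDerivativePoly.

(** * Primitives of Laurent polynomials in [w] *)

Section LaurentPrimitive.
Variable R : realType.
Implicit Types (T : {poly CC R}) (w : CC R).

(* The constant coefficients of both polynomials are [0] since [x / 0 = 0]. *)
Definition prim_pos T e := \poly_(k < (size T).+1) (T`_(e + k) / (two_pi_i R * k%:R)).
Definition prim_neg T e := \poly_(k < e.+1) (- T`_(e - k) / (two_pi_i R * k%:R)).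

Lemma laurent_primitive T e w : w != 0 ->
  T`_e + (theta (prim_pos T e)).[w] - (theta (prim_neg T e)).[w^-1] = T.[w] / w ^+ e.
Proof.
move=> w0; have tpi := two_pi_i_neq0 R.
have sth (A : {poly CC R}) : (size (theta A) <= size A)%N.
  by apply/leq_sizeP => i Ai; rewrite coef_theta nth_default ?mulr0.
rewrite (@horner_coef_wide _ (size T).+1 (theta (prim_pos T e))); last first.
  exact: leq_trans (sth _) (size_poly _ _).
rewrite (@horner_coef_wide _ e.+1 (theta (prim_neg T e))); last first.
  exact: leq_trans (sth _) (size_poly _ _).
rewrite (@horner_coef_wide _ (e.+1 + size T) T) ?leq_addl//.
rewrite big_split_ord /= mulrDl.
have kn0 k : k.+1%:R != 0 :> CC R by rewrite pnatr_eq0.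
have -> : (\sum_(i < size T) T`_(e.+1 + i) * w ^+ (e.+1 + i)) / w ^+ e =
    \sum_(i < (size T).+1) (theta (prim_pos T e))`_i * w ^+ i.
  rewrite mulr_suml big_ord_recl /= coef_theta mulr0 !mul0r add0r.
  apply: eq_bigr => k _; rewrite /bump /= add1n coef_theta coef_poly ltnS ltn_ord.
  rewrite addnS addSn [_ * (_ / _)]mulrC divfK ?mulf_neq0//.
  by rewrite -addnS exprD; field; rewrite expf_neq0.
have -> : (\sum_(i < e.+1) T`_i * w ^+ i) / w ^+ e =
    T`_e - \sum_(i < e.+1) (theta (prim_neg T e))`_i * w^-1 ^+ i.
  rewrite (reindex_inj rev_ord_inj) /= mulr_suml !big_ord_recl /= coef_theta mulr0 !mul0r add0r.
  rewrite subSS subn0 mulfK ?expf_neq0//; congr (_ + _); rewrite -sumrN.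
  apply: eq_bigr => k _; rewrite /bump /= add1n subSS coef_theta coef_poly ltnS ltn_ord.
  rewrite [_ * (_ / _)]mulrC divfK ?mulf_neq0// mulNr opprK -mulrA; congr (_ * _).
  have -> : w ^+ e = w ^+ (e - k.+1) * w ^+ k.+1 by rewrite -exprD subnK.
  rewrite exprVn; set a := w ^+ _; set b := w ^+ _; field.
  by rewrite !expf_neq0.
ring.
Qed.

End LaurentPrimitive.

(** * Partial fractions for [l = 1] and integration of [F' / F] *)

Section Forward.
Variables (R : realType) (F : CC R -> CC R) (p q : {poly CC R}).
Hypothesis entF : entire F.
Hypothesis zeroF : exists z0 : CC R, F z0 = 0.
Hypothesis nzF : exists z1 : CC R, F z1 != 0.
Hypothesis cop : coprimep p q.
Hypothesis q00 : q.[0] != 0.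
Hypothesis qroot : exists w : CC R, root q w.
Hypothesis spq : (size p <= size q)%N.
Hypothesis newtonE : forall z : CC R, cderiv F z != 0 -> q.[wexp z] != 0 ->
  newton F z = (1 : int)%:~R * z + p.[wexp z] / q.[wexp z].

Lemma newton1_den z : newton_den 1 p q z = - p.[wexp z].
Proof. by rewrite newton_denE subrr !mul0r sub0r. Qed.

Lemma root_residue x : x != 0 -> root p x ->
  exists n : nat, q.[x] = - (n.+1%:R * (two_pi_i R * x * p^`().[x])).
Proof.
move=> x0 /rootP px; have [z zE] := cexp_surj x0; rewrite -/(wexp z) in zE.
have dz : newton_den 1 p q z = 0 by rewrite newton1_den zE px oppr0.
have [n] := newton_den_residue entF zeroF nzF cop q00 qroot newtonE dz.
rewrite zE => ->; exists n; rewrite -mulrN; congr (_ * _).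
rewrite /newton_den' /epoly /eder /theta /= subrr scale0r deriv0 mulr0 scaler0 horner0 mulr0.
by rewrite !add0r derivN hornerZ hornerM hornerX hornerN zE; ring.
Qed.

(* [-q / p = 2 pi i X P' / P + T / X^e]: the partial fraction decomposition,
   whose residues at the nonzero poles are the multiplicities of [P]. *)
Lemma partial_fractions : exists (P T : {poly CC R}) (e : nat),
  [/\ P != 0, P.[0] != 0,
    forall w, w != 0 -> p.[w] != 0 -> P.[w] != 0 /\
      - q.[w] / p.[w] = two_pi_i R * w * P^`().[w] / P.[w] + T.[w] / w ^+ e,
    T`_0 != 0 &
    (size T <= e.+1)%N -> T`_e + two_pi_i R * ((size P).-1)%:R != 0].
Proof.
have p0 := num_neq0 cop qroot; have tpi := two_pi_i_neq0 R.
have [e [S1]] := multiplicity_XsubC p 0; rewrite p0 /= subr0 => S10 pE.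
have S1n0 : S1 != 0 by apply: contraNneq S10 => ->; rewrite root0.
have [rs] := closed_field_poly_normal S1.
set kap := lead_coef S1; set S := \prod_(_ <- _) _ => S1E.
have kap0 : kap != 0 by rewrite lead_coef_eq0.
have rS x : root S1 x = (x \in rs) by rewrite S1E rootZ// root_prod_XsubC.
have rs0 x : x \in rs -> x != 0 by rewrite -rS; apply: contraTneq => ->.
have rsp x : x \in rs -> root p x by rewrite -rS pE rootM => ->.
have [n nP] : exists n : CC R -> nat, forall x, x \in rs ->
    q.[x] = - ((n x).+1%:R * (two_pi_i R * x * p^`().[x])).
  have /choice[n nP] : forall x, exists n : nat, x \in rs ->
      q.[x] = - (n.+1%:R * (two_pi_i R * x * p^`().[x])).
    move=> x; have [xrs|_] := boolP (x \in rs); last by exists 0%N.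
    by have [n nE] := root_residue (rs0 x xrs) (rsp x xrs); exists n.
  by exists n.
have p'E x : x \in rs -> p^`().[x] = kap * x ^+ e * S^`().[x].
  move=> xrs; have /rootP Sx : root S x by rewrite root_prod_XsubC.
  rewrite pE S1E derivM derivZ hornerD !hornerM !hornerZ Sx mulr0 mul0r addr0 hornerXn.
  by ring.
(* At a multiple root [p'] would vanish, and the residue formula [nP] would make [q] vanish together
   with [p]. *)
have urs : uniq rs.
  rewrite -separable_prod_XsubC -/S separable_poly.unlock; apply: Pdiv.ClosedField.root_coprimep => x.
  rewrite root_prod_XsubC => xrs; apply/eqP => S'x.
  have /rootP px := rsp x xrs; have := nP x xrs; rewrite p'E// S'x !mulr0 oppr0.
  by move=> /(not_common_root cop); rewrite px eqxx.
have [L [PL sL cL LV]] := logder_poly n urs.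
set P := \prod_(x <- rs) ('X - x%:P) ^+ (n x).+1 in PL cL.
rewrite -/S in PL LV.
have mP : P \is monic by apply: monic_prod => y _; rewrite monic_exp// monicXsubC.
have rP w : root P w = (w \in rs) by exact: root_prod_XsubC_exp.
have sS : size S = (size rs).+1 by rewrite size_prod_XsubC.
have mS : S \is monic by exact: monic_prod_XsubC.
(* Since [p = kap X^e S], this is the numerator over [p] of [- q / p - 2 pi i X P' / P]. The
   multiplicities in [P] match the residues, so it vanishes on [rs] and [S] divides it. *)
pose Num := - q - (two_pi_i R * kap) *: ('X^(e.+1) * L).
have [T0 T0E] : exists T0, Num = T0 * S.
  apply: uniq_roots_prod_XsubC; last by rewrite uniq_rootsE.
  apply/allP => x xrs; apply/rootP; rewrite /Num hornerD !hornerN hornerZ hornerM hornerXn.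
  by rewrite nP// LV// p'E// exprS; ring.
pose T := kap^-1 *: T0.
have qE : - q = kap *: (two_pi_i R *: ('X^(e.+1) * L) + T * S).
  rewrite scalerDr scalerA /T -scalerAl scalerA divff// scale1r -T0E /Num.
  by rewrite [kap * _]mulrC; ring.
have P0 : P != 0 by exact: monic_neq0.
exists P, T, e; split => //.
- by apply/negP => /rootP/eqP; rewrite -/(root P 0) rP => /rs0; rewrite eqxx.
- move=> w w0 pw.
  have wrs : w \notin rs by apply: contra pw => /rsp/rootP ->.
  have Pw : P.[w] != 0 by rewrite -rootE rP.
  have Sw : S.[w] != 0 by rewrite -rootE root_prod_XsubC.
  split=> //.
  have -> : - q.[w] = kap * (two_pi_i R * (w ^+ e.+1 * L.[w]) + T.[w] * S.[w]).
    by rewrite -hornerN qE hornerZ hornerD hornerZ !hornerM hornerXn.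
  have -> : p.[w] = kap * S.[w] * w ^+ e by rewrite pE S1E hornerM hornerZ hornerXn.
  have LE : L.[w] = P^`().[w] * S.[w] / P.[w].
    by rewrite -hornerM PL hornerM mulrC mulKf.
  have we : w ^+ e != 0 by rewrite expf_neq0.
  by rewrite LE exprS; field; rewrite kap0 we Pw Sw.
- rewrite -horner_coef0; apply/eqP => T00; have := congr1 (horner^~ 0) qE.
  rewrite hornerN hornerZ hornerD hornerZ !hornerM hornerXn expr0n T00 /= !mul0r mulr0 addr0 mulr0.
  by move/eqP; rewrite oppr_eq0 (negbTE q00).
(* Here [N] is the degree of [p], and the displayed sum is, up to the factor [- kap], the
   coefficient of [q] at [N]. If it were 0, [q] would have smaller degree than [p]. *)
- move=> sT; apply/eqP => Te; pose N := (e + size rs)%N.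
  have sp : size p = N.+1.
    rewrite pE S1E -scalerAl size_scale// size_Mmonic ?monicXn ?monic_neq0// sS size_polyXn.
    by rewrite addnS /= /N addnC addnS.
  have TSN : (T * S)`_N = T`_e by exact: coefM_monic.
  have qN : q`_N = 0.
    apply/eqP; rewrite -oppr_eq0 -coefN qE coefZ coefD coefZ TSN exprSr -mulrA coefXnM.
    by rewrite ltnNge leq_addr /= /N addKn cL addrC Te mulr0.
  have sq : (size q <= N.+1)%N.
    rewrite -size_polyN qE; apply: leq_trans (size_scale_leq _ _) _.
    apply: leq_trans (size_polyD _ _) _; rewrite geq_max; apply/andP; split.
      apply: leq_trans (size_scale_leq _ _) _; apply: leq_trans (size_polyMleq _ _) _.
      by rewrite size_polyXn addSn /= addSn ltnS leq_add2l.
    apply: leq_trans (size_polyMleq _ _) _; rewrite sS addnS /= /N -addSn.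
    by rewrite leq_add2r.
  have : (size q <= N)%N.
    apply/leq_sizeP => k; rewrite leq_eqVlt => /predU1P[<-//|Nk].
    by rewrite nth_default//; exact: leq_trans sq Nk.
  by rewrite leqNgt -sp spq.
Qed.

Lemma CD_wexpV (A : {poly CC R}) z :
  CD (fun x => A.[(wexp x)^-1]) z (- (theta A).[(wexp z)^-1]).
Proof.
have w0 := wexp_neq0 z.
have := CD_comp (CDV w0 (CD_wexp z)) (CD_horner A (wexp z)^-1).
rewrite /theta hornerZ hornerM hornerX; set D := (_ * _); set D' := - _.
suff -> : D = D' by [].
by rewrite /D /D'; field.
Qed.

Lemma newton_in_R1_form : exists (Lam : CC R) (m0 : int) (P Q Qt : {poly CC R}),
  [/\ P.[0] != 0,
     (exists w : CC R, w != 0 /\ root P w),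
     (forall z : CC R,
        let w := cexp (two_pi_i R * z) in
        F z = cexp (Lam * z) * (w ^ m0 * P.[w] * cexp (Q.[w] + Qt.[w^-1]))),
     ((size Q <= 1)%N -> Lam != - two_pi_i R * (m0 + ((size P).-1)%:Z)%:~R) &
     ((size Qt <= 1)%N -> Lam != - two_pi_i R * m0%:~R)].
Proof.
have [P [T [e [P0 P00 pf T0 Tinf]]]] := partial_fractions.
have tpi := two_pi_i_neq0 R.
pose Lam := T`_e; pose Q := prim_pos T e; pose Qt := prim_neg T e.
pose E z := Lam * z + (Q.[wexp z] + Qt.[(wexp z)^-1]).
pose S z := P.[wexp z] * cexp (E z).
have CE z : CD E z (T.[wexp z] / wexp z ^+ e).
  rewrite -laurent_primitive ?wexp_neq0//.
  have := CDD (CDZ Lam (CD_id z)) (CDD (CD_horner_wexp Q z) (CD_wexpV Qt z)).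
  by rewrite mulr1 addrA.
have CS z : CD S z ((theta P).[wexp z] * cexp (E z) +
    P.[wexp z] * (cexp (E z) * (T.[wexp z] / wexp z ^+ e))).
  exact: CDM (CD_horner_wexp P z) (CD_comp (CE z) (CD_cexp (E z))).
pose V := newton_dom 1 p q.
have Vc : cofinite_locally V by exact: newton_dom_cofinite.
have Vo z : V z -> \forall x \near z, V x by exact: newton_dom_open.
have Vp z : V z -> p.[wexp z] != 0 by case=> _; rewrite newton1_den oppr_eq0.
have SV z : V z -> S z != 0.
  move=> Vz; have [Pw _] := pf _ (wexp_neq0 z) (Vp z Vz).
  by rewrite mulf_neq0// cexp_neq0.
(* [S] has the same logarithmic derivative as [F] on [V], so [F / S] is constant there; the equality
   [F = C S] then extends by density. *)
have CG z : V z -> CD (fun x => F x * (S x)^-1) z 0.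
  move=> Vz; have Sz := SV z Vz.
  have := CDM (CD_entire entF z) (CDV Sz (CS z)).
  set D := (_ + _); suff -> : D = 0 by [].
  have [Pw kE] := pf _ (wexp_neq0 z) (Vp z Vz).
  rewrite /D (newton_ode entF zeroF cop q00 qroot newtonE Vz) newton1_den.
  rewrite invrN mulrN -mulNr kE /S /theta hornerZ hornerM hornerX.
  have we : wexp z ^+ e != 0 by rewrite expf_neq0// wexp_neq0.
  by field; rewrite Pw we cexp_neq0.
have [zV Vz _] := cofinite_point 0 Vc ltr01.
pose C := F zV / S zV.
have FE : F =1 (fun z => C * S z).
  apply: (cofinite_eq Vc).
  - by move=> z; exact: CD_continuous (CD_entire entF z).
  - by move=> z; exact: CD_continuous (CDZ C (CS z)).
  move=> z Vz'; have /= := CD0_cofinite_const Vc Vo CG Vz Vz'.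
  by rewrite -/C => <-; rewrite divfK// SV.
have C0 : C != 0.
  by case: nzF => z1; apply: contraNneq => C0; rewrite FE C0 mul0r.
(* A power of [w] can be absorbed into [Lam], hence [m0 = 0]; the constant of integration goes into
   [P]. *)
exists Lam, 0, (C *: P), Q, Qt; split.
- by rewrite hornerZ mulf_neq0.
- case: zeroF => z0 Fz0; exists (wexp z0); split; first exact: wexp_neq0.
  rewrite rootZ//; apply/rootP/eqP; move: Fz0; rewrite FE => /eqP.
  by rewrite mulf_eq0 (negbTE C0) /S mulf_eq0 (negbTE (cexp_neq0 _)) orbF.
- by move=> z /=; rewrite FE /S /E cexpD hornerZ expr0z -/(wexp z); ring.
- rewrite size_scale// add0r => sQ.
  (* A coefficient of [T] of index [i > e] would give [Q] a nonzero coefficient of index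
     [i - e >= 1]. *)
  have /Tinf : (size T <= e.+1)%N.
    apply/leq_sizeP => i ei; apply/eqP; apply: contraT => Ti.
    have iT : (i < size T)%N.
      by rewrite ltnNge; apply: contra Ti => Ti; rewrite nth_default.
    have : Q`_(i - e) = 0 by rewrite nth_default//; apply: leq_trans sQ _; rewrite subn_gt0.
    rewrite coef_poly ltnS leq_subLR (leq_trans (ltnW iT)) ?leq_addl//.
    rewrite (subnKC (ltnW ei)) => /eqP; rewrite mulf_eq0 (negbTE Ti) invr_eq0 mulf_eq0 (negbTE tpi).
    by rewrite pnatr_eq0 subn_eq0 leqNgt ei.
  by rewrite -/Lam mulNr addr_eq0 pmulrn.
(* For [e > 0] the coefficient of [Qt] at [e] is a nonzero multiple of
   [T]_0[. So a constant]Qt[means]e = 0[, and then]Lam = T[_0] is not 0. *)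
- move=> sQt; rewrite mulr0; have e0 : e = 0%N.
    apply/eqP; apply: contraT; rewrite -lt0n => e0.
    have : Qt`_e = 0 by rewrite nth_default//; exact: leq_trans sQt e0.
    rewrite coef_poly ltnSn subnn => /eqP; rewrite mulf_eq0 oppr_eq0 (negbTE T0).
    by rewrite invr_eq0 mulf_eq0 (negbTE tpi) pnatr_eq0 eqn0Ngt e0.
  by rewrite /Lam e0.
Qed.

End Forward.

(** * From the form of F to the Newton map *)

Section Converse.
Variables (R : realType) (F : CC R -> CC R).
Variables (Lam : CC R) (m0 : int) (P Q Qt : {poly CC R}).
Hypothesis entF : entire F.
Hypothesis P00 : P.[0] != 0.
Hypothesis Proot : exists w : CC R, w != 0 /\ root P w.
Hypothesis FE : forall z, F z =
  cexp (Lam * z) * (wexp z ^ m0 * P.[wexp z] * cexp (Q.[wexp z] + Qt.[(wexp z)^-1])).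
Hypothesis cinf : (size Q <= 1)%N -> Lam != - two_pi_i R * (m0 + ((size P).-1)%:Z)%:~R.
Hypothesis czero : (size Qt <= 1)%N -> Lam != - two_pi_i R * m0%:~R.

Implicit Types A : {poly CC R}.

Let c0 := Lam + two_pi_i R * m0%:~R.

Lemma wexpXz z (m : int) : wexp z ^ m = cexp (two_pi_i R * m%:~R * z).
Proof.
have nat_case k : wexp z ^+ k = cexp (two_pi_i R * k%:R * z).
  elim: k => [|k IH]; first by rewrite expr0 mulr0 mul0r cexp0.
  by rewrite exprS IH -cexpD -natr1; congr cexp; ring.
case: m => k; first exact: nat_case.
have := cexpN (two_pi_i R * k.+1%:R * z); rewrite -nat_case => E.
have wk : wexp z ^+ k.+1 != 0 by rewrite expf_neq0// wexp_neq0.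
by apply: (mulfI wk); rewrite -[_ ^ Negz k]/((wexp z ^+ k.+1)^-1) mulfV// NegzE mulrNz mulrN mulNr E.
Qed.

Definition theta_rev e A : {poly CC R} := \poly_(i < e.+1) (theta A)`_(e - i).

Lemma theta_revE A w : w != 0 ->
  (theta_rev (size A).-1 A).[w] = w ^+ (size A).-1 * (theta A).[w^-1].
Proof.
move=> w0; set e := (size A).-1.
rewrite (@horner_coef_wide _ e.+1 (theta A)); last first.
  apply/leq_sizeP => i ei; rewrite coef_theta nth_default ?mulr0//.
  by apply: leq_trans ei; rewrite /e; case: (size A).
rewrite horner_poly (reindex_inj rev_ord_inj) /= mulr_sumr; apply: eq_bigr => k _.
rewrite subSS subKn; last by rewrite -ltnS ltn_ord.
have -> : w ^+ e = w ^+ (e - k) * w ^+ k by rewrite -exprD subnK// -ltnS ltn_ord.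
by rewrite exprVn; field; rewrite expf_neq0.
Qed.

(** The factor [w^m0] is absorbed into [c0]. The term with [theta P] is not written as a multiple of
    [F], which may vanish at [z]. *)
Lemma CD_form z : exists2 D, CD F z D &
  D = F z * (c0 + (theta Q).[wexp z] - (theta Qt).[(wexp z)^-1])
    + (theta P).[wexp z] * cexp (c0 * z + (Q.[wexp z] + Qt.[(wexp z)^-1])).
Proof.
pose E x := c0 * x + (Q.[wexp x] + Qt.[(wexp x)^-1]).
have FE' x : F x = P.[wexp x] * cexp (E x).
  rewrite FE wexpXz /E /c0 mulrDl -addrA !cexpD; ring.
have CE : CD E z (c0 + ((theta Q).[wexp z] - (theta Qt).[(wexp z)^-1])).
  have := CDD (CDZ c0 (CD_id z)) (CDD (CD_horner_wexp Q z) (CD_wexpV Qt z)).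
  by rewrite mulr1.
have := CDM (CD_horner_wexp P z) (CD_comp CE (CD_cexp (E z))); move=> CF.
eexists; first by apply: CD_ext CF => x; rewrite -FE'.
by rewrite FE' -/(E z); ring.
Qed.

Lemma form_in_R1 : newton_in_Rl F 1.
Proof.
have tpi := two_pi_i_neq0 R.
have P0 : P != 0 by apply: contraNneq P00 => ->; rewrite horner0.
have [rs0 PE] := closed_field_poly_normal P.
pose rs := undup rs0; pose n x := (count_mem x rs0).-1.
have urs : uniq rs by exact: undup_uniq.
have kap0 : lead_coef P != 0 by rewrite lead_coef_eq0.
have P1E : P = lead_coef P *: \prod_(x <- rs) ('X - x%:P) ^+ (n x).+1.
  rewrite {1}PE -prodr_undup_exp_count; congr (_ *: _).
  apply: eq_big_seq => x; rewrite mem_undup /n => xrs; rewrite prednK//.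
  by rewrite -has_count has_pred1.
have [L [PL0 sL cL0 LV]] := logder_poly n urs.
set S := \prod_(x <- rs) ('X - x%:P) in PL0 LV.
have PL : P^`() * S = P * L by rewrite P1E derivZ -!scalerAl PL0.
have cL : ('X * L)`_(size rs) = ((size P).-1)%:R by rewrite cL0 P1E size_scale.
have rP w : root P w = (w \in rs) by rewrite P1E rootZ// root_prod_XsubC_exp.
have rS w : root S w = (w \in rs) by rewrite root_prod_XsubC.
have sS : size S = (size rs).+1 by rewrite size_prod_XsubC.
have mS : S \is monic by exact: monic_prod_XsubC.
have S0 : S != 0 by exact: monic_neq0.
have rs0' : 0 \notin rs by rewrite -rP.
have S00 : S.[0] != 0 by rewrite -rootE rS.
(* [F' / F = c0 + theta Q (w) - theta Qt (1/w) + 2 pi i w L / S]. Multiplying by [w^e] clears the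
   pole at 0, multiplying by [S] the others: the result is [q / (w^e S)], and [p = - w^e S]. *)
pose e := (size Qt).-1; pose B := theta_rev e Qt.
pose A := 'X^e * (c0%:P + theta Q) - B.
pose q := A * S + two_pi_i R *: ('X^e * ('X * L)).
pose p := - ('X^e * S).
have ode z : cderiv F z * (wexp z ^+ e * S.[wexp z]) = F z * q.[wexp z].
  have [D CD1 DE] := CD_form z.
  rewrite (CD_uniq (CD_entire entF z) CD1) DE.
  have -> : F z = P.[wexp z] * cexp (c0 * z + (Q.[wexp z] + Qt.[(wexp z)^-1])).
    by rewrite FE wexpXz /c0 mulrDl -addrA !cexpD; ring.
  have PLw := congr1 (horner^~ (wexp z)) PL; rewrite /= !hornerM in PLw.
  have -> : q.[wexp z] = (wexp z ^+ e * (c0 + (theta Q).[wexp z]) -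
      wexp z ^+ e * (theta Qt).[(wexp z)^-1]) * S.[wexp z] +
      two_pi_i R * (wexp z ^+ e * (wexp z * L.[wexp z])).
    rewrite /q hornerD hornerZ !hornerM hornerXn hornerX.
    by rewrite /A hornerD hornerN hornerM hornerXn hornerD hornerC theta_revE ?wexp_neq0.
  rewrite mulrDl [X in _ + X](_ : _ = cexp (c0 * z + (Q.[wexp z] + Qt.[(wexp z)^-1])) *
    (two_pi_i R * wexp z * wexp z ^+ e) * (P^`().[wexp z] * S.[wexp z])); last first.
    by rewrite {1}/theta hornerZ hornerM hornerX; ring.
  by rewrite PLw; ring.
(* [A.[0]] is [c0] when [Qt] is constant, nonzero by [czero]; otherwise it is [- 2 pi i e] times the
   leading coefficient of [Qt]. *)
have q00 : q.[0] != 0.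
  have -> : q.[0] = A.[0] * S.[0].
    by rewrite /q hornerD hornerZ !hornerM hornerX mul0r !mulr0 addr0.
  rewrite mulf_neq0// /A hornerD hornerN hornerM hornerXn hornerD hornerC.
  have -> : (theta Q).[0] = 0 by rewrite /theta hornerZ hornerM hornerX mul0r mulr0.
  have -> : B.[0] = two_pi_i R * e%:R * Qt`_e.
    by rewrite horner_coef0 coef_poly /= subn0 coef_theta.
  have [e0|en0] := eqVneq e 0%N.
    have sQt : (size Qt <= 1)%N by move: e0; rewrite /e; case: (size Qt) => // -[].
    rewrite e0 expr0 mulr0 mul0r subr0 addr0 mul1r; have := czero sQt.
    by apply: contraNneq => E; rewrite -subr_eq0 -E /c0; apply/eqP; ring.
  rewrite expr0n (negbTE en0) mul0r sub0r oppr_eq0 !mulf_neq0 ?pnatr_eq0//.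
  rewrite -lead_coefE lead_coef_eq0; apply: contraNneq en0 => Qt0.
  by rewrite /e Qt0 size_poly0.
have qS w : w \in rs -> q.[w] != 0.
  move=> wrs; have /rootP Sw : root S w by rewrite rS.
  have w0 : w != 0 by apply: contraTneq wrs => ->.
  rewrite /q hornerD hornerZ !hornerM Sw mulr0 add0r hornerXn hornerX LV//.
  rewrite !mulf_neq0 ?expf_neq0 ?pnatr_eq0//.
  have : separable_poly S by rewrite separable_prod_XsubC.
  by rewrite separable_poly.unlock => /coprimep_root; apply; rewrite rS.
have sp : size p = (e + size rs).+1.
  rewrite /p size_polyN size_Mmonic ?monic_neq0 ?monicXn// sS size_polyXn.
  by rewrite addnS.
have coefA k : A`_(e + k) = (c0%:P + theta Q)`_k.
  rewrite /A coefB coefXnM ltnNge leq_addr /= addKn coef_poly.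
  case: k => [|k]; last by rewrite addnS ltnNge ltnS leq_addr /= subr0.
  by rewrite addn0 ltnSn subnn coef_theta mulr0 mul0r subr0.
pose d := (size Q).-1.
have sA : (size A <= (e + d).+1)%N.
  apply/leq_sizeP => i edi; have ei : (e <= i)%N by apply: leq_trans (ltnW edi); rewrite leq_addr.
  have kd : (d < i - e)%N by rewrite ltn_subRL.
  rewrite -(subnKC ei) coefA coefD coefC coef_theta.
  case: (i - e)%N kd => // k kd; rewrite add0r [Q`__]nth_default ?mulr0//.
  by apply: leq_trans kd; rewrite /d; case: (size Q).
have qd : q`_(e + d + size rs) = (c0%:P + theta Q)`_d + two_pi_i R * ('X * L)`_(d + size rs).
  have AS : (A * S)`_(e + d + size rs) = A`_(e + d) by exact: coefM_monic.
  rewrite /q [LHS]coefD AS coefA coefZ -addnA coefXnM.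
  by rewrite ltnNge leq_addr /= addKn.
(* When [Q] is constant this coefficient is [c0 + 2 pi i deg P], nonzero by [cinf]; otherwise it is
   [2 pi i d] times the leading coefficient of [Q]. As its index is at least the degree of [p], it
   yields finiteness at infinity. *)
have qd0 : q`_(e + d + size rs) != 0.
  rewrite qd coefD coefC coef_theta; have [d0|dn0] := eqVneq d 0%N.
    have sQ : (size Q <= 1)%N by move: d0; rewrite /d; case: (size Q) => // -[].
    rewrite d0 add0n cL mulr0 mul0r addr0; have := cinf sQ; apply: contraNneq => E.
    rewrite -subr_eq0 -E /c0 mulNr opprK intrD mulrDr addrA -pmulrn; apply/eqP; ring.
  have -> : ('X * L)`_(d + size rs) = 0.
    move: dn0; rewrite -lt0n => d0; rewrite coefXM addn_eq0 eqn0Ngt d0 /=.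
    rewrite nth_default// (leq_trans sL)// -ltnS prednK ?addn_gt0 ?d0//.
    by rewrite -[X in (X < _)%N]add0n ltn_add2r.
  rewrite add0r mulr0 addr0 !mulf_neq0 ?pnatr_eq0//.
  rewrite -lead_coefE lead_coef_eq0; apply: contraNneq dn0 => Q0.
  by rewrite /d Q0 size_poly0.
have spq : (size p <= size q)%N.
  rewrite sp ltnNge; apply: contra qd0 => sq; rewrite nth_default//.
  by apply: leq_trans sq _; rewrite leq_add2r leq_addr.
have q0 : q != 0 by apply: contraNneq q00 => ->; rewrite horner0.
have p0 : p != 0 by rewrite oppr_eq0 mulf_neq0// -size_poly_gt0 size_polyXn.
have [w1 [w10 w1P]] := Proot.
have w1rs : w1 \in rs by rewrite -rP.
exists p, q; split; last first.
  move=> z; rewrite -/(wexp z) => d0 qz; rewrite /newton mul1r /p hornerN hornerM hornerXn.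
  rewrite mulNr; congr (_ - _); apply/eqP; rewrite eqr_div// -ode; apply/eqP; ring.
split => //.
- apply: Pdiv.ClosedField.root_coprimep => w.
  rewrite /p rootN rootM => /orP[|]; last by rewrite rS => /qS.
  rewrite rootE hornerXn expf_eq0 => /andP[_ /eqP ->]; exact: q00.
- have /closed_nonrootP[w2] : p * q != 0 by rewrite mulf_neq0.
  rewrite rootM negb_or => /andP[pw2 qw2]; exists w1, w2; split=> //; first exact: qS.
  rewrite /p hornerN hornerM; have /rootP -> : root S w1 by rewrite rS.
  by rewrite mulr0 oppr0 mul0r eq_sym mulf_neq0// invr_eq0.
- apply/closed_rootP; apply/eqP => sq1; move: spq; rewrite sq1 sp ltnS leqn0 addn_eq0.
  by move=> /andP[_ /eqP/size0nil rs_nil]; rewrite rs_nil in w1rs.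
Qed.

End Converse.

Theorem theoremC (R : realType) (F : CC R -> CC R) (l : int) :
  entire F ->
  (exists z0 : CC R, F z0 = 0) ->
  (exists z1 : CC R, F z1 != 0) ->
  newton_in_Rl F l <->
  (l = 1 /\
   exists (Lam : CC R) (m0 : int) (P Q Qt : {poly CC R}),
     [/\ P.[0] != 0,
         (exists w : CC R, w != 0 /\ root P w),
         (forall z : CC R,
            let w := cexp (two_pi_i R * z) in
            F z = cexp (Lam * z) * (w ^ m0 * P.[w] * cexp (Q.[w] + Qt.[w^-1]))),
         ((size Q <= 1)%N -> Lam != - two_pi_i R * (m0 + ((size P).-1)%:Z)%:~R) &
         ((size Qt <= 1)%N -> Lam != - two_pi_i R * m0%:~R)]).
Proof.
move=> entF zF nzF; split.
  move=> [p [q [[cop _ q00 spq qroot] newtonE]]].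
  have l1 := newton_l_eq1 entF zF nzF cop q00 qroot newtonE.
  by split=> //; rewrite l1 in newtonE; exact: newton_in_R1_form newtonE.
move=> [-> [Lam [m0 [P [Q [Qt [P00 Proot FE cinf czero]]]]]]].
exact: form_in_R1 entF P00 Proot FE cinf czero.
Qed.
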